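(* Let $\gamma_->2$ and $p_+\in(0,1)$ be constants and let $(p,\gamma,k)\in\Lambda_{\gamma_-,p_+}$. Then, with probability tending to $1$ as $n\to\infty$, in the $k$-clique removal process $(G_m)_{m\ge0}$ with random initial graph $G_0\sim G(n,p)$ we have \[Q(G_m)\in\big[\widetilde Q(m)(1-g_Q(m)),\ \widetilde Q(m)(1+g_Q(m))\big]\] for all $m<m_*$.
   Context: $E_p(n,k)=\binom{n}{k}p^{\binom{k}{2}}$, $\gamma(p,n,k)=\log E_p(n,k)/\log n$. $\Lambda_{\gamma_-,p_+}$ is the family of triples of sequences $(p_n,\gamma_n,k_n)$ with $p_n\in(0,p_+)$, $\log p_n/\log n\to0$, $k_n\ge\log_{1/p_n}n$, $\gamma_n=\gamma(p_n,n,k_n)\ge\gamma_-$ for all $n$. The $k$-clique removal process: $G_0\sim G(n,p)$; given $G_m$ containing at least one $k$-clique, choose a $k$-clique $K$ of $G_m$ uniformly at random and let $G_{m+1}$ be $G_m$ with the edges of $K$ removed; the process stops when the current graph has no $k$-clique. $Q(G)$ is the number of $k$-cliques in $G$; note $e(G_m)=e(G_0)-m\binom{k}{2}$. Define $\delta=\min\{\gamma-2,1\}/10$, \[\widetilde Q(m)=n^{\gamma}\prod_{i=0}^{m-1}\Big(1-\frac{\binom{k}{2}^2}{e(G_0)-i\binom{k}{2}}\Big),\qquad g_Q(m)=2n^{-\delta}\prod_{i=0}^{m-1}\Big(1+\frac{\binom{k}{2}^2}{e(G_0)-i\binom{k}{2}}\Big),\] and $m_*=\min\{\lfloor \delta pn^2\log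 n/(4k^4)\rfloor,\ pn^2/(2k^2)\}$. *)

(* Defs.v *)
From HB Require Import structures.
From mathcomp Require Export all_boot all_order all_algebra.
From mathcomp Require Export all_classical all_reals all_analysis.
Export Order.TTheory GRing.Theory Num.Theory.
Export numFieldNormedType.Exports.

#[export] Set Implicit Arguments.
#[export] Unset Strict Implicit.
#[export] Unset Printing Implicit Defensive.

Local Open Scope classical_set_scope.
Local Open Scope ring_scope.

Definition edge (n : nat) : finType := {e : {set 'I_n} | #|e| == 2%N}.

(* A simple graph on the vertex set 'I_n is its set of edges. *)
Definition graph (n : nat) : finType := {set edge n}.

Definition edges_within (n : nat) (K : {set 'I_n}) : graph n :=
  [set e : edge n | val e \subset K]%SET.

(* Cliques are identified with their vertex sets. *)
Definition cliques (n k : nat) (G : graph n) : {set {set 'I_n}} :=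
  [set K : {set 'I_n} | (#|K| == k) && (edges_within K \subset G)]%SET.

Definition num_cliques (n k : nat) (G : graph n) : nat := #|cliques k G|.

Definition expected_cliques (R : realType) (p : R) (n k : nat) : R :=
  'C(n, k)%:R * p ^+ 'C(k, 2).

Definition gamma_exponent (R : realType) (p : R) (n k : nat) : R :=
  ln (expected_cliques p n k) / ln n%:R.

(* The bound on gamma is only required for large n: as gamma_minus > 2, it
   cannot hold at n = 2, where gamma_exponent p 2 k <= 1 for p in (0, 1). *)
Record in_Lambda (R : realType) (gamma_minus p_plus : R)
    (p gamma : nat -> R) (k : nat -> nat) : Prop := InLambda {
  Lambda_p : forall n, 0 < p n < p_plus ;
  Lambda_log_p : ln (p n) / ln n%:R @[n --> \oo] --> (0 : R) ;
  Lambda_k : forall n, ln n%:R / ln (p n)^-1 <= (k n)%:R ;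
  Lambda_gamma : forall n, gamma n = gamma_exponent (p n) n (k n) ;
  Lambda_gamma_ge : \forall n \near \oo, gamma_minus <= gamma n }.

Definition delta (R : realType) (gamma : R) : R := Num.min (gamma - 2) 1 / 10.

(* e0 stands for e(G_0). *)
Definition Q_tilde (R : realType) (n k : nat) (gamma : R) (e0 m : nat) : R :=
  n%:R `^ gamma *
  \prod_(0 <= i < m) (1 - 'C(k, 2)%:R ^+ 2 / (e0%:R - i%:R * 'C(k, 2)%:R)).

Definition g_Q (R : realType) (n k : nat) (gamma : R) (e0 m : nat) : R :=
  2 * n%:R `^ (- delta gamma) *
  \prod_(0 <= i < m) (1 + 'C(k, 2)%:R ^+ 2 / (e0%:R - i%:R * 'C(k, 2)%:R)).

Definition m_star (R : realType) (n k : nat) (p gamma : R) : R :=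
  Num.min
    (Num.floor (delta gamma * p * n%:R ^+ 2 * ln n%:R / (4 * k%:R ^+ 4)))%:~R
    (p * n%:R ^+ 2 / (2 * k%:R ^+ 2)).

Definition gnp_mass (R : realType) (n : nat) (p : R) (G : graph n) : R :=
  p ^+ #|G| * (1 - p) ^+ ('C(n, 2) - #|G|).

(* The state None means that the process has already stopped. *)
Definition removal_step (R : realType) (n k : nat)
    (x y : option (graph n)) : R :=
  match x, y with
  | None, None => 1
  | None, Some _ => 0
  | Some G, None => if num_cliques k G == 0%N then 1 else 0
  | Some G, Some G' =>
      if num_cliques k G == 0%N then 0
      else #|[set K in cliques k G | G' == G :\: edges_within K]%SET|%:R
           / (num_cliques k G)%:R
  end.

Record clique_removal_process (R : realType) (n k : nat) (p : R)
    (d : measure_display) (T : measurableType d) (P : probability T R)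
    (G : nat -> T -> option (graph n)) : Prop := CliqueRemovalProcess {
  process_measurable : forall m x, measurable [set w | G m w = x] ;
  process_init : forall H : graph n,
    P [set w | G 0%N w = Some H] = (gnp_mass p H)%:E ;
  process_step : forall (m : nat) (h : nat -> option (graph n)),
    P [set w | forall i, (i <= m.+1)%N -> G i w = h i] =
    (P [set w | forall i, (i <= m)%N -> G i w = h i] *
     (removal_step R k (h m) (h m.+1))%:E)%E }.

(* In particular the process has not stopped before any step m < m_star. *)
Definition clique_count_tracked (R : realType) (n k : nat) (p gamma : R)
    (T : Type) (G : nat -> T -> option (graph n)) : set T :=
  [set w | exists2 G0 : graph n, G 0%N w = Some G0 &
    forall m : nat, m%:R < m_star n k p gamma ->
    exists2 Gm : graph n, G m w = Some Gm &
      (num_cliques k Gm)%:R \in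
        `[ Q_tilde n k gamma #|G0| m * (1 - g_Q n k gamma #|G0| m),
           Q_tilde n k gamma #|G0| m * (1 + g_Q n k gamma #|G0| m) ] ].

(* Main.v *)
Require Import Defs.
From mathcomp Require Import all_boot all_order all_algebra.
From mathcomp Require Import all_classical all_reals all_analysis.
From mathcomp Require Import ring lra zify.
Import Order.TTheory GRing.Theory Num.Theory.
Import numFieldNormedType.Exports.

(** Write [N = C(k,2)], [q_e] for the number of k-cliques through the edge [e],
    [V] for the sum over edges of the squared deviation of [q_e] from its mean
    [N Q / e(G)], and [D] for the number of pairs of cliques with at least two
    common edges (weighted by the square of their number).  The number of pairs
    of cliques that share an edge lies between [N^2 Q^2 / e(G) + V - D] and
    [N^2 Q^2 / e(G) + V], so one step multiplies [Q] by [1 - N^2 / e(G)] on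
    average, up to an error [(V + D) / Q].

    The point is that [V] cannot grow much.  Call an edge light if [q_e] is at
    most three times the mean.  A heavy edge only loses cliques, so its squared
    deviation does not increase.  For light edges the linear term of the drift
    is a positive semidefinite form (the sum over cliques of the square of the
    total deviation) up to terms of order [V N^2 / e(G)] and [D N^2 / e(G)].
    Hence [E V_(m+1) <= (1 + 18 N^2 / e) V_m + 11 (N^2 / e) D], and over [m_*]
    steps [V] grows by at most a factor [n^(45 delta / 8)].  As [D] can only
    decrease, it is enough to bound [D] and [V] in [G(n, p)], where the second
    moment method gives [n^(2 gamma - 2 - 10 delta + o(1))].  A potential made
    of [(Q / prod (1 - N^2 / e_i) - n^gamma)^2] and [V] is then a
    supermartingale, which bounds the probability of leaving the tube. *)

Local Open Scope ring_scope.

(** * Degrees in uniform hypergraphs *)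

(** The initial graph is controlled only by second moments and Markov's inequality, without a union
    bound over edges. A single [q_e] is therefore known only to be at most [n^(gamma - 1 + o(1))],
    while the mean degree is [n^(gamma - 2 + o(1))]. This gap is why heavy edges need an argument of
    their own. The 10 in the definition of [delta] pays for the losses. In units of [n^(2 gamma)],
    at most [n^2] steps, each with [V] or [D] of order [n^(-2 - 10 delta)], give [n^(-10 delta)] in
    total. The growth of [V] costs [45/8 delta]; dividing twice by the product of the
    [1 - N^2 / e_i] costs [2 * 5/8 delta]; comparing with the squared relative half-width
    [4 n^(-2 delta)] of the tube costs [2 delta]. Together this is [71/8 delta], and the remaining
    [9/8 delta] absorbs every factor [n^o(1)]. *)

Lemma sqr_sum_le (R : realFieldType) (I : finType) (S : pred I) (u : I -> R) :
  (\sum_(i | S i) u i) ^+ 2 <= #|S|%:R * \sum_(i | S i) u i ^+ 2.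
Proof.
have h : 0 <= \sum_(i | S i) \sum_(j | S j) (u i - u j) ^+ 2.
  by apply: sumr_ge0 => i _; apply: sumr_ge0 => j _; exact: sqr_ge0.
have e1 : \sum_(i | S i) \sum_(j | S j) (u i - u j) ^+ 2 =
   2 * (#|S|%:R * \sum_(i | S i) u i ^+ 2) - 2 * (\sum_(i | S i) u i) ^+ 2.
  transitivity (\sum_(i | S i) (#|S|%:R * u i ^+ 2 - 2 * u i * (\sum_(j | S j) u j)
      + \sum_(j | S j) u j ^+ 2)).
    apply: eq_bigr => i _; rewrite mulr_sumr mulr_natl -sumr_const -sumrB -big_split /=.
    by apply: eq_bigr => j _; ring.
  rewrite big_split /= sumrB -mulr_sumr -mulr_suml -mulr_sumr sumr_const.
  by rewrite -mulr_natl; ring.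
by move: h; rewrite e1; lra.
Qed.

Section Hypergraph.
Variables (R : realFieldType) (Ed KT : finType) (E : KT -> {set Ed}).
Implicit Types (cl : {set KT}) (G : {set Ed}).

Definition incidence e K : R := (e \in E K)%:R.
Definition meet_size K K' : R := #|E K :&: E K'|%:R.
Definition hits_ind K K' : R := (~~ [disjoint E K & E K'])%:R.
Definition degree cl e : R := \sum_(K in cl) incidence e K.
(** With [m] common edges, the weight [m^2] for [m >= 2] dominates both [m - 1], the overcount when
    hits are counted per edge, and [m (m - 1)], the number of ordered pairs of distinct common
    edges. The diagonal [K = K'] is included. *)
Definition overlap K K' : R :=
  if (1 < #|E K :&: E K'|)%N then meet_size K K' ^+ 2 else 0.
Definition overlaps cl : R := \sum_(K in cl) \sum_(K' in cl) overlap K K'.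
Definition mean_degree (N : nat) cl G : R := N%:R * #|cl|%:R / #|G|%:R.
Definition degree_var N cl G : R :=
  \sum_(e in G) (degree cl e - mean_degree N cl G) ^+ 2.
Definition survivors cl K : {set KT} := [set K' in cl | [disjoint E K & E K']].

Lemma inc_ge0 e K : 0 <= incidence e K. Proof. exact: ler0n. Qed.
Lemma inc_le1 e K : incidence e K <= 1. Proof. by rewrite /incidence lern1 leq_b1. Qed.
Lemma incK e K : incidence e K * incidence e K = incidence e K.
Proof. by rewrite /incidence -natrM mulnb andbb. Qed.
Lemma hits_ge0 K K' : 0 <= hits_ind K K'. Proof. exact: ler0n. Qed.
Lemma hits_le1 K K' : hits_ind K K' <= 1. Proof. by rewrite /hits_ind lern1 leq_b1. Qed.
Lemma hitsE K K' : hits_ind K K' = (0 < #|E K :&: E K'|)%:R.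
Proof. by rewrite /hits_ind -finset.setI_eq0 -cards_eq0 lt0n. Qed.
Lemma hits_le_meet K K' : hits_ind K K' <= meet_size K K'.
Proof. by rewrite hitsE /meet_size ler_nat; case: #|_|. Qed.
Lemma overlap_ge0 K K' : 0 <= overlap K K'.
Proof. by rewrite /overlap; case: ifP => _ //; exact: sqr_ge0. Qed.
Lemma overlaps_ge0 cl : 0 <= overlaps cl.
Proof. by apply: sumr_ge0 => K _; apply: sumr_ge0 => K' _; exact: overlap_ge0. Qed.
Lemma degree_ge0 cl e : 0 <= degree cl e.
Proof. by apply: sumr_ge0 => K _; exact: inc_ge0. Qed.

Lemma meet_sub_hits_le K K' : meet_size K K' - hits_ind K K' <= overlap K K'.
Proof.
rewrite hitsE /overlap /meet_size; case: #|_| => [|[|m]] //=; rewrite ?subrr //.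
rewrite -natr1; have : 0 <= (m.+1%:R : R) by []. nra.
Qed.

Lemma meet_falling_le K K' : meet_size K K' * (meet_size K K' - 1) <= overlap K K'.
Proof.
rewrite /overlap /meet_size; case: #|_| => [|[|m]] //=; rewrite ?mul0r ?subrr ?mulr0 //.
have : 0 <= (m.+2%:R : R) by []. nra.
Qed.

Lemma sum_inc_inc G K K' : E K \subset G ->
  \sum_(e in G) incidence e K * incidence e K' = meet_size K K'.
Proof.
move=> sKG; rewrite /meet_size -sumr_const.
rewrite [LHS](bigID (mem (E K :&: E K'))) /= [X in _ + X]big1 ?addr0.
  rewrite [RHS](eq_bigl (fun e => (e \in G) && (e \in E K :&: E K'))).
    by apply: eq_bigr => e /andP[_]; rewrite inE /incidence => /andP[-> ->]; rewrite mulr1.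
  by move=> e; rewrite inE; case: (boolP (e \in E K)) => [/(fintype.subsetP sKG)->|];
    rewrite ?andbF.
by move=> e /andP[_]; rewrite inE /incidence -natrM mulnb => /negbTE ->.
Qed.

Lemma sum_inc G K : E K \subset G -> \sum_(e in G) incidence e K = #|E K|%:R.
Proof.
by move=> sKG; rewrite -[E K in RHS]finset.setIid -/(meet_size K K) -(sum_inc_inc K sKG);
  apply: eq_bigr => e _; rewrite incK.
Qed.

Section Fixed.
Variables (cl : {set KT}) (G : {set Ed}) (N : nat).
Hypotheses (hN : {in cl, forall K, #|E K| = N})
           (hG : {in cl, forall K, E K \subset G}).
Local Notation q := (degree cl).
Local Notation x := (#|cl|%:R : R).
Local Notation mu := (mean_degree N cl G).

Lemma sum_degree_mul (u : Ed -> R) :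
  \sum_(e in G) q e * u e = \sum_(K in cl) \sum_(e in G) incidence e K * u e.
Proof.
by rewrite exchange_big /=; apply: eq_bigr => e _; rewrite mulr_suml.
Qed.

Lemma sum_degree : \sum_(e in G) q e = N%:R * x.
Proof.
under eq_bigr do rewrite -[q _]mulr1.
rewrite sum_degree_mul -sumr_const mulr_natl -sumrMnl; apply: eq_bigr => K Kcl.
under eq_bigr do rewrite mulr1.
by rewrite sum_inc ?hG // hN.
Qed.

Lemma cardG_gt0 : (0 < N)%N -> cl != finset.set0 -> (0 < #|G|)%N.
Proof.
move=> N0 /finset.set0Pn[K Kcl]; rewrite (leq_trans N0) // -(hN Kcl).
exact/subset_leq_card/hG.
Qed.

Lemma mean_degree_ge0 : 0 <= mu.
Proof. by rewrite /mean_degree !mulr_ge0 ?invr_ge0 ?ler0n. Qed.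

Lemma mean_degree_cardG : (0 < N)%N -> mu * #|G|%:R = N%:R * x.
Proof.
move=> N0; have [c0|c0] := eqVneq cl finset.set0.
  by rewrite /mean_degree c0 cards0 mulr0 !mul0r.
by rewrite /mean_degree mulfVK // pnatr_eq0 -lt0n cardG_gt0.
Qed.

Lemma sum_degree_dev : (0 < N)%N -> \sum_(e in G) (q e - mu) = 0.
Proof.
by move=> N0; rewrite sumrB sum_degree sumr_const -[mu *+ _]mulr_natr mean_degree_cardG ?subrr.
Qed.

Lemma sum_degree_sqr :
  \sum_(e in G) q e ^+ 2 = \sum_(K in cl) \sum_(K' in cl) meet_size K K'.
Proof.
under eq_bigr do rewrite expr2.
rewrite sum_degree_mul; apply: eq_bigr => K Kcl.
under eq_bigr do rewrite mulr_sumr.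
by rewrite exchange_big /=; apply: eq_bigr => K' _; rewrite sum_inc_inc ?hG.
Qed.

Lemma degree_varE : (0 < N)%N ->
  degree_var N cl G = \sum_(e in G) q e ^+ 2 - N%:R ^+ 2 / #|G|%:R * x ^+ 2.
Proof.
move=> N0; rewrite /degree_var.
have -> : \sum_(e in G) (q e - mu) ^+ 2 =
   \sum_(e in G) (q e ^+ 2 - 2 * mu * q e + mu ^+ 2) by apply: eq_bigr => e _; ring.
rewrite big_split /= sumrB -mulr_sumr sum_degree sumr_const -[mu ^+ 2 *+ _]mulr_natr.
have -> : mu ^+ 2 * #|G|%:R = mu * (N%:R * x).
  by rewrite -mean_degree_cardG //; ring.
by rewrite /mean_degree; ring.
Qed.

(** The mean minimises the sum of squares. This allows the variance after a step to be centred at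
    the old mean, and the variance in [G(n, p)] at a constant. *)
Lemma degree_var_le (c : R) : (0 < N)%N ->
  degree_var N cl G <= \sum_(e in G) (q e - c) ^+ 2.
Proof.
move=> N0; rewrite /degree_var.
have -> : \sum_(e in G) (q e - c) ^+ 2 =
   \sum_(e in G) ((q e - mu) ^+ 2 + 2 * (mu - c) * (q e - mu) + (mu - c) ^+ 2).
  by apply: eq_bigr => e _; ring.
rewrite !big_split /= -mulr_sumr sum_degree_dev // mulr0 addr0 lerDl.
by apply: sumr_ge0 => e _; exact: sqr_ge0.
Qed.

Lemma sum_hits_le : \sum_(K in cl) \sum_(K' in cl) hits_ind K K' <= \sum_(e in G) q e ^+ 2.
Proof.
by rewrite sum_degree_sqr; apply: ler_sum => K _; apply: ler_sum => K' _;
  exact: hits_le_meet.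
Qed.

Lemma sum_hits_ge :
  \sum_(e in G) q e ^+ 2 - overlaps cl <= \sum_(K in cl) \sum_(K' in cl) hits_ind K K'.
Proof.
rewrite sum_degree_sqr lerBlDr -big_split; apply: ler_sum => K _ /=.
rewrite -big_split; apply: ler_sum => K' _ /=.
have := meet_sub_hits_le K K'; lra.
Qed.

Lemma card_survivors K : #|survivors cl K|%:R = x - \sum_(K' in cl) hits_ind K K'.
Proof.
rewrite -!sum1_card !natr_sum -sumrB /survivors.
rewrite [LHS](eq_bigl (fun K' => (K' \in cl) && [disjoint E K & E K'])); last first.
  by move=> K'; rewrite inE.
rewrite big_mkcondr /=; apply: eq_bigr => K' _.
by rewrite /hits_ind; case: ifP => _ /=; rewrite ?subr0 ?subrr.
Qed.

Lemma sum_hits_row_le (B : R) K : K \in cl -> {in G, forall e, q e <= B} ->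
  \sum_(K' in cl) hits_ind K K' <= N%:R * B.
Proof.
move=> Kcl hB; apply: le_trans (_ : \sum_(K' in cl) meet_size K K' <= _).
  by apply: ler_sum => K' _; exact: hits_le_meet.
under eq_bigr => K' _ do rewrite -(sum_inc_inc K' (hG Kcl)).
rewrite exchange_big /= -(hN Kcl) -(sum_inc (hG Kcl)) mulr_suml.
apply: ler_sum => e eG; rewrite -mulr_sumr ler_wpM2l ?inc_ge0 //.
exact: hB.
Qed.

End Fixed.
End Hypergraph.

(** * Drift of the degree variance when a random edge is removed *)

Section VarianceDrift.
Variables (R : realFieldType) (Ed KT : finType) (E : KT -> {set Ed}).
Variables (cl : {set KT}) (G : {set Ed}) (N : nat).
Hypotheses (hN : {in cl, forall K, #|E K| = N})
           (hG : {in cl, forall K, E K \subset G}) (N4 : (4 <= N)%N).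
Local Notation inc := (@incidence R _ _ E).
Local Notation meet := (@meet_size R _ _ E).
Local Notation hits := (@hits_ind R _ _ E).
Local Notation q := (@degree R _ _ E cl).
Local Notation x := (#|cl|%:R : R).
Local Notation mu := (mean_degree R N cl G).
Local Notation V := (@degree_var R _ _ E N cl G).
Local Notation D := (@overlaps R _ _ E cl).

Let d e := q e - mu.
(** The threshold 3 gives [d > 2 mu], hence [q < 3/2 d], on heavy edges, so that their terms can be
    charged to [VH]. On light edges [d <= 2 mu], so that error terms are bounded by multiples of
    [mu]. *)
Let light e := q e <= 3 * mu.
Let lost e K := \sum_(K' in cl) inc e K' * hits K K'.
(* A lost clique is counted once per edge that it shares with the removed one. *)
Let lostM e K := \sum_(K' in cl) inc e K' * meet K K'.
Let codeg e f := \sum_(K in cl) inc e K * inc f K.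
Let lostL e K := \sum_(f in G | light f) inc f K * codeg e f.
Let lostH e K := \sum_(f in G | ~~ light f) inc f K * codeg e f.
Let VL := \sum_(e in G | light e) d e ^+ 2.
Let VH := \sum_(e in G | ~~ light e) d e ^+ 2.

Let N0 : (0 < N)%N. Proof. exact: leq_trans N4. Qed.
Let mu0 : 0 <= mu. Proof. exact: mean_degree_ge0. Qed.
Let N4R : 4 <= N%:R :> R. Proof. by rewrite ler_nat. Qed.

Let VE : V = VL + VH.
Proof. by rewrite /degree_var (bigID light). Qed.
Let VL0 : 0 <= VL. Proof. by apply: sumr_ge0 => *; exact: sqr_ge0. Qed.
Let VH0 : 0 <= VH. Proof. by apply: sumr_ge0 => *; exact: sqr_ge0. Qed.

Let lost_ge0 e K : 0 <= lost e K.
Proof. by apply: sumr_ge0 => K' _; rewrite mulr_ge0 ?inc_ge0 ?hits_ge0. Qed.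
Let lost_le e K : lost e K <= q e.
Proof. by apply: ler_sum => K' _; rewrite ler_piMr ?inc_ge0 ?hits_le1. Qed.
Let lost_leM e K : lost e K <= lostM e K.
Proof. by apply: ler_sum => K' _; rewrite ler_wpM2l ?inc_ge0 ?hits_le_meet. Qed.
Let codeg_ge0 e f : 0 <= codeg e f.
Proof. by apply: sumr_ge0 => K' _; rewrite mulr_ge0 ?inc_ge0. Qed.
Let lostL_ge0 e K : 0 <= lostL e K.
Proof. by apply: sumr_ge0 => K' _; rewrite mulr_ge0 ?inc_ge0. Qed.
Let lostH_ge0 e K : 0 <= lostH e K.
Proof. by apply: sumr_ge0 => K' _; rewrite mulr_ge0 ?inc_ge0. Qed.
Let dE e : d e = q e - mu. Proof. by []. Qed.

Let lostME e K : K \in cl -> lostM e K = lostL e K + lostH e K.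
Proof.
move=> Kcl; rewrite /lostL /lostH -(bigID light (fun f => f \in G)) /=.
under [RHS]eq_bigr do rewrite mulr_sumr.
rewrite exchange_big /=; apply: eq_bigr => K' _.
rewrite -(sum_inc_inc _ K' (hG Kcl)) mulr_sumr.
by apply: eq_bigr => f _; ring.
Qed.

Let lostM_ge e K : e \in E K -> q e <= lostM e K.
Proof.
move=> eK; apply: ler_sum => K' _; rewrite /incidence.
have [eK'|] := boolP (e \in E K'); last by rewrite !mul0r.
rewrite mul1r /meet_size ler1n card_gt0; apply/finset.set0Pn; exists e.
by rewrite inE eK.
Qed.

(** The degree after the loss lies between 0 and [q e], so the new deviation lies between [- mu] and
    [d e], and [d e > 2 mu]. *)
Let heavy_step e K : ~~ light e -> (1 - inc e K) * (d e - lost e K) ^+ 2 <= d e ^+ 2.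
Proof.
rewrite -ltNge => h; have l0 := lost_ge0 e K; have l1 := lost_le e K.
have h2 : (d e - lost e K) ^+ 2 <= d e ^+ 2.
  by move: l0 l1 h mu0 (dE e); move: (lost e K) (d e) (q e) mu => *; nra.
apply: le_trans h2; rewrite ler_piMl ?sqr_ge0 //.
by have := inc_ge0 R E e K; lra.
Qed.

(** For [e] outside [K], the square is expanded: replacing [lost] by [lostM] in the linear term
    costs [2 d (lostM - lost)] with [d <= 2 mu]. For [e] in [K] the left side is 0, and the terms
    with [inc e K] make the right side nonnegative, because [lostM >= q] and [d <= 2 mu]. *)
Let light_step e K : K \in cl -> light e ->
  (1 - inc e K) * (d e - lost e K) ^+ 2 <=
  d e ^+ 2 - 2 * (d e * lostM e K) + 2 * (inc e K * (d e * q e))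
  + 4 * mu * (inc e K * (lostM e K - q e)) + 4 * mu * (lostM e K - lost e K)
  + (1 - inc e K) * lostL e K ^+ 2 + 6 * mu * lostH e K.
Proof.
rewrite /light => Kcl le; have l0 := lost_ge0 e K; have l1 := lost_le e K.
have l2 := lost_leM e K; have L0 := lostL_ge0 e K; have H0 := lostH_ge0 e K.
have lM := lostME e Kcl.
have := dE e; rewrite /incidence; have [eK|_] := boolP (e \in E K).
  have l3 := lostM_ge eK.
  move: lM l0 l1 l2 l3 L0 H0 le mu0.
  move: (lost e K) (lostM e K) (lostL e K) (lostH e K) (d e) (q e) mu.
  move=> lo loM a b dd qq m -> *; subst dd.
  have t1 : 0 <= (6 * m - 2 * qq) * (a + b - qq) by rewrite mulr_ge0; lra.
  have t2 : 0 <= m * (a + b - lo) by rewrite mulr_ge0 //; lra.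
  have t3 : 0 <= m * b by rewrite mulr_ge0.
  have t4 := sqr_ge0 (qq - m).
  rewrite subrr !mul0r !mul1r addr0; lra.
move: lM l0 l1 l2 L0 H0 le mu0.
move: (lost e K) (lostM e K) (lostL e K) (lostH e K) (d e) (q e) mu.
move=> lo loM a b dd qq m -> l0 l1 l2 a0 b0 le m0 ->.
rewrite !subr0 !mul0r !mulr0 !mul1r !addr0.
(* If [lo > a], then [lo - a <= b], and [lo + a <= 6 m] because [lo <= qq <= 3 m]. *)
have h1 : lo ^+ 2 <= a ^+ 2 + 6 * m * b.
  have [h|h] := leP lo a; first by nra.
  have : (lo - a) * (lo + a) <= b * (6 * m) by apply: ler_pM; lra.
  by lra.
nra.
Qed.

Let sum_light_dev : \sum_(e in G | light e) d e = - \sum_(e in G | ~~ light e) d e.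
Proof.
apply/eqP; rewrite -subr_eq0 opprK; apply/eqP.
by have := sum_degree_dev R hN hG N0; rewrite (bigID light).
Qed.

Let heavy_dev_ge0 : 0 <= \sum_(e in G | ~~ light e) d e.
Proof. by apply: sumr_ge0 => e /andP[_]; rewrite -ltNge /d; move: mu0; lra. Qed.

(** Exchanging the two cliques turns the sum into [DL K * (N mu + DL K + DH K)], with [DL] and [DH]
    the total deviations of the light and heavy edges of [K]. The square of [DL] is dropped, and
    [DL >= - N mu] bounds the mixed product from below. What remains are first moments, where the
    light deviations sum to minus the heavy ones and [2 mu d <= d^2] on heavy edges. *)
Let drift_main :
  mu * N%:R * (VL - 2 * VH) <=
  \sum_(K in cl) \sum_(e in G | light e) d e * lostM e K.
Proof.
pose DL K := \sum_(e in G | light e) inc e K * d e.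
pose DH K := \sum_(e in G | ~~ light e) inc e K * d e.
have NmuE K : K \in cl -> N%:R * mu = \sum_(e in G) inc e K * mu.
  by move=> Kcl; rewrite -mulr_suml sum_inc ?hG // hN.
have -> : \sum_(K in cl) \sum_(e in G | light e) d e * lostM e K =
    \sum_(K in cl) DL K * (N%:R * mu + DL K + DH K).
  have tE K : K \in cl -> \sum_(K' in cl) meet K' K = N%:R * mu + DL K + DH K.
    move=> Kcl; under eq_bigr => K' K'cl do rewrite -(sum_inc_inc _ K (hG K'cl)).
    rewrite exchange_big /= -addrA -(bigID light (fun f => f \in G)) /=.
    rewrite (NmuE K Kcl) -big_split /=.
    by apply: eq_bigr => e _; rewrite -mulr_suml -/(q e) /d; ring.
  under eq_bigr => K _ do under eq_bigr => e _ do rewrite mulr_sumr.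
  under eq_bigr => K _ do rewrite exchange_big /=.
  rewrite exchange_big /=; apply: eq_bigr => K Kcl.
  rewrite -(tE K Kcl) mulr_sumr; apply: eq_bigr => K' _.
  by rewrite mulr_suml; apply: eq_bigr => e _; ring.
have DLge K : K \in cl -> - (N%:R * mu) <= DL K.
  move=> Kcl; rewrite (NmuE K Kcl) -sumrN.
  rewrite [leLHS](bigID light) /= /DL.
  rewrite -[leRHS]addr0; apply: lerD.
    apply: ler_sum => e _; have := inc_ge0 R E e K.
    by have := degree_ge0 R E cl e; rewrite /d; move: mu0; nra.
  apply: sumr_le0 => e _; have := inc_ge0 R E e K; move: mu0; nra.
have DHge K : 0 <= DH K.
  apply: sumr_ge0 => e /andP[_]; rewrite -ltNge /d => h.
  by apply: mulr_ge0; [exact: inc_ge0|move: mu0; lra].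
apply: (@le_trans _ _ (\sum_(K in cl) (N%:R * mu * DL K - N%:R * mu * DH K))); last first.
  apply: ler_sum => K Kcl; have := DLge K Kcl; have := DHge K.
  by have := sqr_ge0 (DL K); move: (DL K) (DH K) (N%:R * mu) => *; nra.
rewrite sumrB -!mulr_sumr /DL /DH.
have sw (P : pred Ed) : \sum_(K in cl) \sum_(e in G | P e) inc e K * d e =
    \sum_(e in G | P e) (d e ^+ 2 + mu * d e).
  rewrite exchange_big /=; apply: eq_bigr => e _.
  by rewrite -mulr_suml -/(q e) /d; ring.
rewrite !sw !big_split /= -!mulr_sumr sum_light_dev -/VL -/VH.
have hd : 2 * mu * \sum_(e in G | ~~ light e) d e <= VH.
  rewrite /VH mulr_sumr; apply: ler_sum => e /andP[_]; rewrite -ltNge /d.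
  by move: mu0; nra.
have Nmu : 0 <= mu * N%:R by rewrite mulr_ge0.
move: hd Nmu; move: VL VH (\sum_(e in G | ~~ light e) d e) mu N%:R => *; nra.
Qed.

Let drift_self :
  \sum_(K in cl) \sum_(e in G | light e) inc e K * (d e * q e) <= 4 * mu * VL.
Proof.
have -> : \sum_(K in cl) \sum_(e in G | light e) inc e K * (d e * q e) =
    \sum_(e in G | light e) (d e ^+ 2 * q e + mu * d e ^+ 2 + mu ^+ 2 * d e).
  rewrite exchange_big /=; apply: eq_bigr => e _.
  by rewrite -mulr_suml -/(q e) /d; ring.
rewrite !big_split /= -!mulr_sumr sum_light_dev -/VL.
have : \sum_(e in G | light e) d e ^+ 2 * q e <= 3 * mu * VL.
  rewrite mulr_sumr; apply: ler_sum => e /andP[_ le]; rewrite mulrC.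
  by rewrite ler_wpM2r ?sqr_ge0.
have : 0 <= mu ^+ 2 * \sum_(e in G | ~~ light e) d e by rewrite mulr_ge0 ?sqr_ge0.
lra.
Qed.

Let drift_inner :
  \sum_(K in cl) \sum_(e in G | light e) inc e K * (lostM e K - q e) <= D.
Proof.
apply: (@le_trans _ _ (\sum_(K in cl) \sum_(e in G) inc e K * (lostM e K - q e))).
  apply: ler_sum => K _; rewrite [leRHS](bigID light) /= lerDl.
  apply: sumr_ge0 => e _; rewrite /incidence.
  have [eK|] := boolP (e \in E K); last by rewrite mul0r.
  by rewrite mul1r subr_ge0 lostM_ge.
apply: ler_sum => K Kcl.
under eq_bigr do rewrite /lostM /degree -sumrB mulr_sumr.
rewrite exchange_big /=; apply: ler_sum => K' _.
under eq_bigr do rewrite -{2}[inc _ K']mulr1 -mulrBr mulrA.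
by rewrite -mulr_suml sum_inc_inc ?hG // meet_falling_le.
Qed.

Let drift_double :
  \sum_(K in cl) \sum_(e in G | light e) (lostM e K - lost e K) <= N%:R * D.
Proof.
apply: (@le_trans _ _ (\sum_(K in cl) \sum_(e in G) (lostM e K - lost e K))).
  apply: ler_sum => K _; rewrite [leRHS](bigID light) /= lerDl.
  by apply: sumr_ge0 => e _; rewrite subr_ge0.
rewrite /overlaps mulr_sumr; apply: ler_sum => K Kcl.
under eq_bigr do rewrite /lostM /lost -sumrB.
rewrite exchange_big /= mulr_sumr; apply: ler_sum => K' K'cl.
under eq_bigr do rewrite -mulrBr.
rewrite -mulr_suml sum_inc ?hG // hN //.
by rewrite ler_wpM2l ?meet_sub_hits_le.
Qed.

(** Over all pairs of edges the squared codegrees sum to the squared [meet] over pairs of cliques.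
    The diagonal [e = f] carries the sum of [meet], which leaves [meet (meet - 1)]. *)
Let sum_codeg_sqr :
  \sum_(e in G) \sum_(f in G | f != e) codeg e f ^+ 2 <= D.
Proof.
have sq e : e \in G -> \sum_(f in G | f != e) codeg e f ^+ 2 =
   \sum_(f in G) codeg e f ^+ 2 - q e ^+ 2.
  move=> eG; rewrite [X in _ = X - _](bigD1 e) //=.
  have -> : codeg e e = q e by apply: eq_bigr => K _; rewrite incK.
  by ring.
rewrite (eq_bigr _ sq) sumrB sum_degree_sqr // lerBlDr.
have -> : \sum_(e in G) \sum_(f in G) codeg e f ^+ 2 =
    \sum_(K in cl) \sum_(K' in cl) meet K K' ^+ 2.
  under eq_bigr => e _ do under eq_bigr => f _ do
    (rewrite expr2 mulr_suml; under eq_bigr do rewrite mulr_sumr).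
  under eq_bigr => e _ do rewrite exchange_big /=.
  rewrite exchange_big /=; apply: eq_bigr => K Kcl.
  under eq_bigr => e _ do rewrite exchange_big /=.
  rewrite exchange_big /=; apply: eq_bigr => K' Kcl'.
  rewrite expr2 -!(sum_inc_inc _ K' (hG Kcl)) mulr_suml; apply: eq_bigr => e _.
  by rewrite mulr_sumr; apply: eq_bigr => f _; ring.
rewrite /overlaps -big_split /=; apply: ler_sum => K _.
rewrite -big_split /=; apply: ler_sum => K' _.
by have := meet_falling_le R E K K'; lra.
Qed.

(** Cauchy-Schwarz is applied to the at most [N] light edges [f] of [K]. The factor [1 - inc e K]
    forces [f] to differ from [e], so only off-diagonal codegrees occur. Lightness then bounds the
    number [q f] of cliques through [f] by [3 mu]. *)
Let drift_light_sqr :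
  \sum_(K in cl) \sum_(e in G | light e) (1 - inc e K) * lostL e K ^+ 2
  <= 3 * mu * (N%:R * D).
Proof.
apply: (@le_trans _ _ (\sum_(K in cl) \sum_(e in G)
    \sum_(f in G | (f != e) && light f) N%:R * (inc f K * codeg e f ^+ 2))).
  apply: ler_sum => K Kcl; rewrite [leRHS](bigID light) /= -[leLHS]addr0.
  apply: lerD; last first.
    apply: sumr_ge0 => e _; apply: sumr_ge0 => f _.
    by rewrite !mulr_ge0 ?inc_ge0 ?sqr_ge0.
  apply: ler_sum => e _; rewrite /incidence; have [eK|eK] := boolP (e \in E K).
    rewrite subrr mul0r; apply: sumr_ge0 => f _.
    by rewrite !mulr_ge0 ?inc_ge0 ?sqr_ge0.
  rewrite subr0 mul1r -mulr_sumr.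
  pose S f := [&& f \in G, light f & f \in E K].
  have -> : lostL e K = \sum_(f | S f) codeg e f.
    rewrite /lostL (bigID (fun f => f \in E K)) /= [X in _ + X]big1 ?addr0.
      rewrite (eq_bigl S); last by move=> f; rewrite /S andbA.
      by apply: eq_bigr => f /and3P[_ _ fK]; rewrite /incidence fK mul1r.
    by move=> f /andP[_ /negbTE fK]; rewrite /incidence fK mul0r.
  apply: le_trans (sqr_sum_le _ _) _; apply: ler_pM => //.
  - by apply: sumr_ge0 => f _; rewrite sqr_ge0.
  - rewrite ler_nat -(hN Kcl); apply: subset_leq_card; apply/fintype.subsetP => f.
    by move=> /and3P[].
  - rewrite [leRHS](bigID (fun f => f \in E K)) /= -[leLHS]addr0; apply: lerD.
      rewrite [leRHS](eq_bigl S); last first.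
        move=> f; rewrite /S; case: (boolP (f \in E K)) => fK; rewrite ?andbF //.
        rewrite !andbT; case: (eqVneq f e) => // fe.
        by move: eK; rewrite -fe fK.
      by apply: ler_sum => f /and3P[_ _ fK]; rewrite fK mul1r.
    by apply: sumr_ge0 => f _; rewrite !mulr_ge0 ?sqr_ge0.
rewrite exchange_big /=.
apply: (@le_trans _ _ (\sum_(e in G) \sum_(f in G | f != e) 3 * mu * N%:R * codeg e f ^+ 2)).
  apply: ler_sum => e _; rewrite exchange_big /=.
  rewrite [leRHS](bigID light) /= -[leLHS]addr0; apply: lerD.
    rewrite [leRHS](eq_bigl (fun f => (f \in G) && (f != e) && light f)) //.
    rewrite [leLHS](eq_bigl (fun f => (f \in G) && (f != e) && light f)); last first.
      by move=> f; rewrite andbA.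
    apply: ler_sum => f /andP[_ lf]; rewrite -mulr_sumr -mulr_suml -/(q f).
    have := sqr_ge0 (codeg e f); move: lf N4R mu0; rewrite /light.
    move: (q f) (codeg e f ^+ 2) mu N%:R => qf c m n h1 h2 h3 h4.
    have : qf * (n * c) <= 3 * m * (n * c) by apply: ler_wpM2r => //; nra.
    lra.
  by apply: sumr_ge0 => f _; rewrite !mulr_ge0 ?sqr_ge0.
under eq_bigr do rewrite -mulr_sumr.
rewrite -mulr_sumr [leRHS]mulrA ler_wpM2l // !mulr_ge0 //.
Qed.

(** Double counting gives [N * q f ^+ 2] for each heavy edge [f], and [q f <= 3/2 d f] there. *)
Let drift_heavy :
  \sum_(K in cl) \sum_(e in G | light e) lostH e K <= N%:R * (9 / 4 * VH).
Proof.
apply: (@le_trans _ _ (\sum_(K in cl) \sum_(e in G) lostH e K)).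
  apply: ler_sum => K _; rewrite [leRHS](bigID light) /= lerDl.
  by apply: sumr_ge0.
under eq_bigr do rewrite exchange_big /=.
rewrite exchange_big /= mulrA /VH mulr_sumr; apply: ler_sum => f /andP[fG].
rewrite -ltNge => hf; under eq_bigr do rewrite -mulr_sumr.
rewrite -mulr_suml -/(q f).
have -> : \sum_(e in G) codeg e f = N%:R * q f.
  rewrite exchange_big /= mulr_sumr; apply: eq_bigr => K Kcl.
  by rewrite -mulr_suml sum_inc ?hG // hN.
have h : q f ^+ 2 <= 9 / 4 * d f ^+ 2 by move: hf mu0; rewrite /d; nra.
by have := ler_wpM2l (ler0n R N) h; lra.
Qed.

Lemma degree_survivors K e : degree R E (survivors E cl K) e = q e - lost e K.
Proof.
rewrite /degree /lost -sumrB /survivors.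
rewrite [LHS](eq_bigl (fun K' => (K' \in cl) && [disjoint E K & E K'])); last first.
  by move=> K'; rewrite inE.
rewrite big_mkcondr /=; apply: eq_bigr => K' _.
by rewrite /hits_ind; case: ifP => _ /=; rewrite ?mulr0 ?mulr1 ?subr0 ?subrr.
Qed.

Lemma sum_degree_var_survivors_le :
  \sum_(K in cl) @degree_var R _ _ E N (survivors E cl K) (G :\: E K) <=
  x * V + mu * N%:R * (18 * V + 11 * D).
Proof.
apply: (@le_trans _ _ (\sum_(K in cl) \sum_(e in G) (1 - inc e K) * (d e - lost e K) ^+ 2)).
  apply: ler_sum => K Kcl.
  have h1 : {in survivors E cl K, forall K', #|E K'| = N}.
    by move=> K'; rewrite inE => /andP[/hN].
  have h2 : {in survivors E cl K, forall K', E K' \subset G :\: E K}.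
    move=> K'; rewrite inE => /andP[/hG sG]; rewrite disjoint_sym => dj.
    by rewrite finset.subsetD sG.
  (* The centre stays at the old mean, so the change of the mean in the step never has to be
     estimated. *)
  apply: le_trans (degree_var_le h1 h2 mu N0) _.
  rewrite [leRHS](bigID (fun e => e \in E K)) /= -[leLHS]add0r; apply: lerD.
    apply: sumr_ge0 => e _; rewrite mulr_ge0 ?sqr_ge0 // subr_ge0 inc_le1 //.
  rewrite [leLHS](eq_bigl (fun e => (e \in G) && (e \notin E K))); last first.
    by move=> e; rewrite inE andbC.
  apply: ler_sum => e /andP[_ /negbTE eK].
  by rewrite degree_survivors /incidence eK subr0 mul1r /d addrAC.
apply: (@le_trans _ _ (\sum_(K in cl) (VH + \sum_(e in G | light e)
  (d e ^+ 2 - 2 * (d e * lostM e K) + 2 * (inc e K * (d e * q e))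
  + 4 * mu * (inc e K * (lostM e K - q e)) + 4 * mu * (lostM e K - lost e K)
  + (1 - inc e K) * lostL e K ^+ 2 + 6 * mu * lostH e K)))).
  apply: ler_sum => K Kcl; rewrite (bigID light) /= addrC; apply: lerD.
    by apply: ler_sum => e /andP[_ he]; exact: heavy_step.
  by apply: ler_sum => e /andP[_ he]; exact: light_step.
pose s1 := \sum_(K in cl) \sum_(e in G | light e) d e * lostM e K.
pose s2 := \sum_(K in cl) \sum_(e in G | light e) inc e K * (d e * q e).
pose s3 := \sum_(K in cl) \sum_(e in G | light e) inc e K * (lostM e K - q e).
pose s4 := \sum_(K in cl) \sum_(e in G | light e) (lostM e K - lost e K).
pose s5 := \sum_(K in cl) \sum_(e in G | light e) (1 - inc e K) * lostL e K ^+ 2.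
pose s6 := \sum_(K in cl) \sum_(e in G | light e) lostH e K.
apply: (@le_trans _ _ (x * VH + (x * VL - 2 * s1 + 2 * s2 + 4 * mu * s3 +
    4 * mu * s4 + s5 + 6 * mu * s6))).
  rewrite big_split /= sumr_const -[VH *+ _]mulr_natl lerD2l le_eqVlt; apply/orP; left.
  have -> : x * VL = \sum_(K in cl) VL by rewrite sumr_const mulr_natl.
  apply/eqP; rewrite /s1 /s2 /s3 /s4 /s5 /s6 !mulr_sumr.
  rewrite -sumrB -!big_split /=; apply: eq_bigr => K _.
  by rewrite /VL !mulr_sumr -sumrB -!big_split /=; apply: eq_bigr => e _.
have h1 : _ <= s1 := drift_main; have h2 : s2 <= _ := drift_self.
have h3 : s3 <= _ := drift_inner; have h4 : s4 <= _ := drift_double.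
have h5 : s5 <= _ := drift_light_sqr; have h6 : s6 <= _ := drift_heavy.
clearbody s1 s2 s3 s4 s5 s6.
rewrite VE.
have D0 := overlaps_ge0 R E cl.
(* Bookkeeping in units of [mu N]: since [N >= 4], the self term [8 mu VL] is cancelled by the gain
   [- 2 VL] of the main term. The coefficient of [VH] is [4 + 27/2 <= 18], and that of [D] is
   [4 + 4 + 3 = 11]. *)
have g2 : 8 * (mu * VL) <= 2 * (mu * N%:R * VL).
  have := ler_wpM2l VL0 N4R => h; have := ler_wpM2l mu0 h; lra.
have g3 : 4 * mu * s3 <= mu * N%:R * (4 * D).
  have t1 : mu * s3 <= mu * D by rewrite ler_wpM2l.
  have t2 : mu * D * 4 <= mu * D * N%:R by rewrite ler_wpM2l // mulr_ge0.
  have t3 : 0 <= mu * D by rewrite mulr_ge0.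
  lra.
have g4 : 4 * mu * s4 <= mu * N%:R * (4 * D).
  have t1 : mu * s4 <= mu * (N%:R * D) by rewrite ler_wpM2l.
  lra.
have g6 : 6 * mu * s6 <= mu * N%:R * (27 / 2 * VH).
  have t1 : mu * s6 <= mu * (N%:R * (9 / 4 * VH)) by rewrite ler_wpM2l.
  lra.
have g7 : 0 <= mu * N%:R * VH by rewrite !mulr_ge0.
have g8 : 0 <= mu * N%:R * VL by rewrite !mulr_ge0.
lra.
Qed.

End VarianceDrift.

(** * The binomial random graph *)

Section Gnp.
Variables (R : realType) (n : nat).
Implicit Types (p : R) (A H : graph n).

Lemma card_edge : #|edge n| = 'C(n, 2).
Proof.
rewrite -[n in RHS]card_ord -card_draws card_sig; apply: eq_card => e.
by rewrite !inE.
Qed.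

Lemma card_edges_within (K : {set 'I_n}) : #|edges_within K| = 'C(#|K|, 2).
Proof.
rewrite -cards_draws -(card_imset _ val_inj); apply: eq_card => B.
apply/imsetP/idP => [[e]|].
  by rewrite !inE => eK ->; rewrite eK (valP e).
rewrite inE => /andP[BK B2]; exists (exist _ B B2 : edge n) => //.
by rewrite inE.
Qed.

Lemma edges_withinI (K K' : {set 'I_n}) :
  edges_within K :&: edges_within K' = edges_within (K :&: K').
Proof. by apply/setP => e; rewrite !inE finset.subsetI. Qed.

Lemma cliques_remove k H (K : {set 'I_n}) :
  cliques k (H :\: edges_within K) = survivors (@edges_within n) (cliques k H) K.
Proof.
apply/setP => K'; rewrite !inE finset.subsetD disjoint_sym.
by rewrite andbA.
Qed.

Definition gnp_mean p (f : graph n -> R) : R := \sum_H gnp_mass p H * f H.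

Lemma gnp_massE p H :
  gnp_mass p H = \prod_(e : edge n) (if e \in H then p else 1 - p).
Proof.
rewrite /gnp_mass (bigID (mem H)) /=; congr (_ * _).
  by rewrite (eq_bigr (fun=> p)) ?prodr_const // => e ->.
rewrite (eq_bigr (fun=> 1 - p)); last by move=> e /negbTE ->.
by rewrite prodr_const -card_edge -(cardC (mem H)) addKn.
Qed.

Lemma gnp_mass_ge0 p H : 0 <= p <= 1 -> 0 <= gnp_mass p H.
Proof. by move=> /andP[p0 p1]; rewrite mulr_ge0 ?exprn_ge0 ?subr_ge0. Qed.

(** A product over edges of (present + absent) weights is expanded over all edge sets. Giving weight
    0 to the absence of an edge of [A] keeps exactly the supersets of [A], while each other factor
    is [p + (1 - p) = 1]. *)
Lemma gnp_mean_sub p A : gnp_mean p (fun H => (A \subset H)%:R) = p ^+ #|A|.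
Proof.
pose F (e : edge n) := p; pose F' (e : edge n) := if e \in A then 0 else 1 - p.
transitivity (\prod_(e : edge n) (F e + F' e)); last first.
  rewrite (bigID (mem A)) /= [X in _ * X]big1; last first.
    by move=> e /negbTE eA; rewrite /F /F' eA; ring.
  rewrite mulr1 (eq_bigr (fun=> p)) ?prodr_const // => e eA.
  by rewrite /F /F' eA addr0.
rewrite bigA_distr /gnp_mean; apply: eq_bigr => H _.
rewrite gnp_massE; case: (boolP (A \subset H)) => AH.
  rewrite mulr1; apply: eq_bigr => e _; rewrite /F /F'.
  by case: (boolP (e \in A)) => // /(fintype.subsetP AH) ->.
rewrite mulr0; apply/esym/eqP; rewrite prodf_seq_eq0; apply/hasP.
move/subsetPn: AH => [e eA eH]; exists e; first by rewrite mem_index_enum.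
by rewrite (negbTE eH) /F' eA /=.
Qed.

Lemma gnp_mean_sum p (I : finType) (Q : pred I) (f : I -> graph n -> R) :
  gnp_mean p (fun H => \sum_(i | Q i) f i H) = \sum_(i | Q i) gnp_mean p (f i).
Proof.
by rewrite /gnp_mean exchange_big /=; apply: eq_bigr => H _; rewrite mulr_sumr.
Qed.

Lemma gnp_meanZ p c (f : graph n -> R) :
  gnp_mean p (fun H => c * f H) = c * gnp_mean p f.
Proof. by rewrite /gnp_mean mulr_sumr; apply: eq_bigr => H _; ring. Qed.

Lemma gnp_meanD p (f g : graph n -> R) :
  gnp_mean p (fun H => f H + g H) = gnp_mean p f + gnp_mean p g.
Proof. by rewrite /gnp_mean -big_split; apply: eq_bigr => H _ /=; ring. Qed.

Lemma eq_gnp_mean p (f g : graph n -> R) : f =1 g -> gnp_mean p f = gnp_mean p g.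
Proof. by move=> fg; apply: eq_bigr => H _; rewrite fg. Qed.

Lemma gnp_mean_cst p c : gnp_mean p (fun=> c) = c.
Proof.
transitivity (gnp_mean p (fun H => c * (finset.set0 \subset H)%:R)).
  by apply: eq_gnp_mean => H; rewrite finset.sub0set mulr1.
by rewrite gnp_meanZ gnp_mean_sub cards0 mulr1.
Qed.

Lemma sum_gnp_mass p : \sum_(H : graph n) gnp_mass p H = 1.
Proof. by rewrite -(gnp_mean_cst p 1); apply: eq_bigr => H _; rewrite mulr1. Qed.

Lemma ler_gnp_mean p (f g : graph n -> R) : 0 <= p <= 1 ->
  (forall H, f H <= g H) -> gnp_mean p f <= gnp_mean p g.
Proof.
by move=> p01 fg; apply: ler_sum => H _; rewrite ler_wpM2l ?gnp_mass_ge0.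
Qed.

Lemma gnp_markov p (f : graph n -> R) (c t : R) (Q : pred (graph n)) :
  0 <= p <= 1 -> (forall H, 0 <= f H) -> gnp_mean p f <= c -> 0 < t ->
  (forall H, Q H -> t <= f H) -> \sum_(H | Q H) gnp_mass p H <= c / t.
Proof.
move=> p01 f0 fc t0 Qt; rewrite ler_pdivlMr // mulr_suml.
apply: le_trans fc; rewrite /gnp_mean [leRHS](bigID Q) /= -[leLHS]addr0.
apply: lerD; last by apply: sumr_ge0 => H _; rewrite mulr_ge0 ?gnp_mass_ge0.
by apply: ler_sum => H QH; rewrite ler_wpM2l ?gnp_mass_ge0 // Qt.
Qed.

Lemma gnp_mean_card p : gnp_mean p (fun H => #|H|%:R) = 'C(n, 2)%:R * p.
Proof.
transitivity (gnp_mean p (fun H => \sum_(e : edge n) ([set e]%SET \subset H)%:R)).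
  apply: eq_gnp_mean => H; rewrite -sum1_card natr_sum big_mkcond /=.
  by apply: eq_bigr => e _; rewrite finset.sub1set; case: ifP.
rewrite gnp_mean_sum; under eq_bigr do rewrite gnp_mean_sub cards1 expr1.
by rewrite sumr_const card_edge mulr_natl.
Qed.

Lemma gnp_card_var p : 0 <= p <= 1 ->
  gnp_mean p (fun H => (#|H|%:R - 'C(n, 2)%:R * p) ^+ 2) <= 'C(n, 2)%:R * p.
Proof.
move=> /andP[p0 p1]; set C := 'C(n, 2)%:R : R.
have e2 : gnp_mean p (fun H => #|H|%:R ^+ 2) <= C * p + (C * p) ^+ 2.
  have -> : gnp_mean p (fun H => #|H|%:R ^+ 2) =
     \sum_(e : edge n) \sum_(f : edge n) p ^+ #|[set e; f]%SET|.
    transitivity (gnp_mean p (fun H => \sum_(e : edge n) \sum_(f : edge n)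
        ([set e; f]%SET \subset H)%:R)).
      apply: eq_gnp_mean => H; rewrite -sum1_card natr_sum big_mkcond /= expr2.
      rewrite mulr_suml; apply: eq_bigr => e _; rewrite mulr_sumr.
      apply: eq_bigr => f _; rewrite finset.subUset !finset.sub1set.
      by case: ifP; case: ifP; rewrite ?mulr1 ?mulr0.
    rewrite gnp_mean_sum; apply: eq_bigr => e _; rewrite gnp_mean_sum.
    by apply: eq_bigr => f _; rewrite gnp_mean_sub.
  have -> : C * p + (C * p) ^+ 2 = \sum_(e : edge n) (p + C * p ^+ 2).
    by rewrite sumr_const card_edge -mulr_natl -/C; ring.
  apply: ler_sum => e _; rewrite (bigD1 e) //= finset.setUid cards1 expr1 lerD2l.
  rewrite /C -card_edge -sum1_card natr_sum mulr_suml.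
  rewrite [leRHS](bigID (fun f => f != e)) /= -[leLHS]addr0; apply: lerD.
    by apply: ler_sum => f fe; rewrite cards2 eq_sym fe mul1r.
  by apply: sumr_ge0 => *; rewrite mul1r sqr_ge0.
have -> : gnp_mean p (fun H => (#|H|%:R - C * p) ^+ 2) =
    gnp_mean p (fun H => #|H|%:R ^+ 2 + (- (2 * C * p) * #|H|%:R + (C * p) ^+ 2)).
  by apply: eq_gnp_mean => H; ring.
rewrite !gnp_meanD gnp_meanZ gnp_mean_card gnp_mean_cst -/C.
by move: (gnp_mean _ _) e2 => u e2; lra.
Qed.

End Gnp.

(** * Failure probabilities from potentials *)

Section FiniteCovers.
Local Open Scope classical_set_scope.

Lemma measure_le_sum d (T : measurableType d) (R : realType)
    (mu : {measure set T -> \bar R}) (I : eqType) (r : seq I)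
    (F : I -> set T) (A : set T) :
  (forall i, measurable (F i)) -> measurable A ->
  (forall w, A w -> exists2 i, i \in r & F i w) ->
  (mu A <= \sum_(i <- r) mu (F i))%E.
Proof.
move=> mF; elim: r A => [|i r IHr] A mA hA.
  have -> : A = set0.
    by apply/seteqP; split => // w /hA [].
  by rewrite measure0 big_nil.
rewrite big_cons.
have mAF : measurable (A `\` F i) by exact: measurableD.
apply: (@le_trans _ _ (mu (F i) + mu (A `\` F i)))%E; last first.
  apply: leeD => //; apply: IHr => // w [Aw nF].
  have [j] := hA w Aw; rewrite inE => /orP[/eqP ->|jr] Fj; last by exists j.
  by have := nF Fj.
apply: le_trans (measureU2 _ _ _) => //.
apply: le_measure; rewrite ?inE //; first exact: measurableU.
by move=> w Aw; have [Fw|nF] := pselect (F i w); [left|right].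
Qed.

Lemma sum_measure_le d (T : measurableType d) (R : realType)
    (mu : {measure set T -> \bar R}) (I : eqType) (r : seq I)
    (F : I -> set T) (A : set T) :
  uniq r -> (forall i, measurable (F i)) -> measurable A ->
  (forall i w, F i w -> A w) -> (forall i j w, F i w -> F j w -> i = j) ->
  (\sum_(i <- r) mu (F i) <= mu A)%E.
Proof.
move=> + mF mA hA dj.
have {hA} : forall i w, i \in r -> F i w -> A w by move=> i w _; exact: hA.
elim: r A mA => [|i r IHr] A mA hA; first by rewrite big_nil measure_ge0.
rewrite big_cons => /= /andP[ir ur].
have mAF : measurable (A `\` F i) by exact: measurableD.
rewrite (_ : A = F i `|` (A `\` F i)); last first.
  apply/seteqP; split => w.
    by move=> Aw; have [Fw|nF] := pselect (F i w); [left|right].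
  by case=> [|[]] // /hA; apply; rewrite mem_head.
rewrite measureU //; last by rewrite setDE setICA setICr setI0.
apply: leeD => //; apply: IHr => // j w jr Fj; split.
  by apply: hA Fj; rewrite inE jr orbT.
by move=> Fi; move: ir; rewrite (dj _ _ _ Fi Fj) jr.
Qed.

End FiniteCovers.

Section Process.
Local Open Scope classical_set_scope.
Variables (R : realType) (n k : nat) (p : R) (d : measure_display).
Variables (T : measurableType d) (P : probability T R).
Variables (G : nat -> T -> option (graph n)).
Hypothesis hG : clique_removal_process k p P G.

Definition history m (h : nat -> option (graph n)) : set T :=
  [set w | forall i, (i <= m)%N -> G i w = h i].

(** [None] counts as bad, so avoiding failure includes that the process is still running. *)
Definition good_state (good : nat -> graph n -> bool) i (s : option (graph n)) :=
  if s is Some H then good i H else false.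

Definition fails good m M : set T :=
  [set w | exists2 i, (m <= i <= M)%N & ~~ good_state good i (G i w)].

Lemma measurable_state i (B : set (option (graph n))) :
  measurable [set w | B (G i w)].
Proof.
have -> : [set w | B (G i w)] = \bigcup_(x in B) [set w | G i w = x].
  by apply/seteqP; split => [w Bw|w [x Bx /= ->]//]; exists (G i w).
apply: fin_bigcup_measurable; first exact: finite_finset.
by move=> x _; exact: process_measurable hG _ _.
Qed.

Lemma measurable_history m h : measurable (history m h).
Proof.
have -> : history m h = \bigcap_(i in [set i | (i <= m)%N]) [set w | G i w = h i].
  by apply/seteqP; split.
by apply: bigcap_measurableType => i _; exact: process_measurable hG _ _.
Qed.

Lemma measurable_fails good m M : measurable (fails good m M).
Proof.
have -> : fails good m M = \bigcup_(i in [set i | (m <= i <= M)%N])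
    [set w | ~~ good_state good i (G i w)] by apply/seteqP; split.
apply: bigcup_measurable => i _.
exact: (measurable_state i [set s | ~~ good_state good i s]).
Qed.

Lemma removal_step_Some_gt0 (H H' : graph n) :
  removal_step R k (Some H) (Some H') != 0 ->
  exists2 K, K \in cliques k H & H' = H :\: edges_within K.
Proof.
rewrite /removal_step; case: ifP => _; first by rewrite eqxx.
rewrite mulf_eq0 negb_or pnatr_eq0 => /andP[].
rewrite cards_eq0 => /finset.set0Pn[K]; rewrite inE => /andP[Kc /eqP ->] _.
by exists K.
Qed.

Lemma sum_removal_step (H : graph n) (Phi : graph n -> R) :
  (0 < num_cliques k H)%N ->
  \sum_(H' : graph n) removal_step R k (Some H) (Some H') * Phi H' =
  (\sum_(K in cliques k H) Phi (H :\: edges_within K)) / (num_cliques k H)%:R.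
Proof.
rewrite lt0n => /negbTE x0; rewrite /removal_step x0 mulr_suml.
rewrite (partition_big (fun K => H :\: edges_within K : graph n) predT) //=.
apply: eq_bigr => H' _; rewrite -sum1_card natr_sum !mulr_suml.
rewrite [LHS](eq_bigl (fun K => (K \in cliques k H) &&
   (H :\: edges_within K == H'))); last by move=> K; rewrite inE [H' == _]eq_sym.
by apply: eq_bigr => K /andP[_ /eqP ->]; rewrite mul1r mulrC.
Qed.

(** * Failure bounds by backward induction on the time left *)

Section Potential.
Variables (I : nat -> graph n -> Prop) (good : nat -> graph n -> bool).
Variables (Psi : nat -> graph n -> R) (M : nat).
Hypothesis Psi0 : forall m H, (m <= M)%N -> 0 <= Psi m H.
Hypothesis Psi1 : forall m H, (m <= M)%N -> I m H -> ~~ good m H -> 1 <= Psi m H.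
Hypothesis Isurv : forall m H K, (m < M)%N -> I m H -> good m H ->
  K \in cliques k H -> I m.+1 (H :\: edges_within K).
Hypothesis live : forall m H, (m < M)%N -> I m H -> good m H ->
  (0 < num_cliques k H)%N.
Hypothesis Psi_super : forall m H, (m < M)%N -> I m H -> good m H ->
  \sum_(K in cliques k H) Psi m.+1 (H :\: edges_within K) <=
  (num_cliques k H)%:R * Psi m H.

(** Optional stopping without martingales: the induction on the number [j] of remaining steps
    conditions on the whole history. A bad state is paid for by [Psi >= 1]; a good one is split
    according to the next state, and the supermartingale inequality averages the bounds. *)
Lemma history_fails_le j m h H : (m + j = M)%N -> h m = Some H -> I m H ->
  (P (history m h `&` fails good m M) <= P (history m h) * (Psi m H)%:E)%E.
Proof.
elim: j m h H => [|j IHj] m h H mjM hm IH.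
  move: mjM; rewrite addn0 => mM.
  have [gH|bH] := boolP (good m H).
    rewrite [X in P X](_ : _ = set0) ?measure0 ?mule_ge0 ?lee_fin ?Psi0 ?mM //.
    apply/seteqP; split => // w [hw [i /andP[mi iM]]].
    have -> : i = m by apply/eqP; rewrite eqn_leq mM mi iM.
    by rewrite mM (hw M) -?mM // hm /good_state gH.
  apply: (@le_trans _ _ (P (history m h))).
    by apply: le_measure; rewrite ?inE;
      [exact: measurableI (measurable_history _ _) (measurable_fails _ _ _)
      |exact: measurable_history|exact: subIsetl].
  by rewrite lee_pemulr ?measure_ge0 // lee_fin; apply: Psi1 => //; rewrite mM.
have mM : (m < M)%N by rewrite -mjM addnS ltnS leq_addr.
have mh m' h' := measurable_history m' h'.
have mf m' := measurable_fails good m' M.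
have [gH|bH] := boolP (good m H); last first.
  apply: (@le_trans _ _ (P (history m h))).
    by apply: le_measure; rewrite ?inE;
      [exact: measurableI|exact: mh|exact: subIsetl].
  by rewrite lee_pemulr ?measure_ge0 // lee_fin Psi1 // ltnW.
pose h' s i := if i == m.+1 then s else h i.
have hE s : P (history m.+1 (h' s)) =
    (P (history m h) * (removal_step R k (Some H) s)%:E)%E.
  rewrite /history (process_step hG) /h' eqxx ltn_eqF // hm.
  congr (P _ * _)%E; apply/seteqP; split => w hw i im.
    by rewrite hw // ltn_eqF.
  by rewrite hw // ltn_eqF.
apply: (@le_trans _ _ (\sum_(s : option (graph n))
    P (history m.+1 (h' s) `&` fails good m.+1 M))%E).
  apply: measure_le_sum.
  - by move=> s; exact: measurableI.
  - exact: measurableI.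
  - move=> w [hw [i /andP[mi iM] bi]]; exists (G m.+1 w).
      by rewrite mem_index_enum.
    split.
      move=> l; rewrite /h'; case: eqP => [->//|/eqP lm lm1].
      by apply: hw; rewrite -ltnS ltn_neqAle lm.
    exists i => //; rewrite iM andbT ltn_neqAle mi andbT.
    by apply: contraNN bi => /eqP <-; rewrite hw // hm.
apply: (@le_trans _ _ (\sum_(s : option (graph n)) P (history m h) *
   (removal_step R k (Some H) s * (if s is Some H' then Psi m.+1 H' else 0))%:E)%E).
  apply: lee_sum => s _.
  have le1 : (P (history m.+1 (h' s) `&` fails good m.+1 M) <=
      P (history m.+1 (h' s)))%E.
    by apply: le_measure; rewrite ?inE;
      [exact: measurableI|exact: mh|exact: subIsetl].
  (* The invariant passes only to graphs reached by removing a clique; histories continued by any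
     other state have probability 0. *)
  have [s0|s0] := eqVneq (removal_step R k (Some H) s) 0.
    by apply: (le_trans le1); rewrite hE s0 mul0r.
  case: s s0 le1 => [H'|] s0 le1; last first.
    exfalso; move: s0; rewrite /removal_step.
    by have := live mM IH gH; rewrite lt0n => /negbTE ->; rewrite eqxx.
  have [K Kc H'E] := removal_step_Some_gt0 s0.
  have IH' : I m.+1 H' by rewrite H'E; exact: Isurv.
  have := IHj m.+1 (h' (Some H')) H' _ _ IH'.
  rewrite addSnnS mjM /h' eqxx -/(h' _) => /(_ erefl erefl).
  by rewrite hE EFinM muleA.
rewrite -ge0_sume_distrr; last first.
  move=> s _; rewrite lee_fin; apply: mulr_ge0; last first.
    by case: s => // H'; exact: Psi0.
  rewrite /removal_step; case: s => [H'|]; case: ifP => _;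
    by rewrite ?ler01 ?lexx ?divr_ge0.
rewrite lee_wpmul2l ?measure_ge0 // sumEFin lee_fin.
rewrite (bigD1 None) //= mulr0 add0r.
rewrite (reindex_omap Some id) //=; last by case.
rewrite (eq_bigl predT); last by move=> H'; rewrite /= eqxx.
have x0 := live mM IH gH.
rewrite sum_removal_step // ler_pdivrMr ?ltr0n // mulrC.
exact: Psi_super.
Qed.

Lemma initial_fails_le H : I 0%N H ->
  (P ([set w | G 0%N w = Some H] `&` fails good 0 M) <=
   (gnp_mass p H * Psi 0 H)%:E)%E.
Proof.
move=> IH; rewrite EFinM -(process_init hG).
have := @history_fails_le M 0%N (fun=> Some H) H erefl erefl IH.
have -> // : history 0 (fun=> Some H) = [set w | G 0%N w = Some H].
apply/seteqP; split => w /=; first by move/(_ 0%N (leqnn _)).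
by move=> h i; rewrite leqn0 => /eqP ->.
Qed.

End Potential.

(** The complement of [A] is covered by a null event, an atypical start, and a failure after a
    typical start. The notion of good state depends on the initial graph because [e(G_0)] enters the
    tube. *)
Lemma tracked_prob_ge (good : graph n -> nat -> graph n -> bool) (M : nat)
    (S : pred (graph n)) (eps : R) (A : set T) :
  0 <= p <= 1 -> 0 <= eps ->
  (forall H, S H ->
    (P ([set w | G 0%N w = Some H] `&` fails (good H) 0 M) <=
     (gnp_mass p H * eps)%:E)%E) ->
  measurable A ->
  (forall w H, G 0%N w = Some H ->
    (forall i, (i <= M)%N -> good_state (good H) i (G i w)) -> A w) ->
  ((1 - \sum_(H | ~~ S H) gnp_mass p H - eps)%:E <= P A)%E.
Proof.
move=> p01 eps0 hS mA hA.
have mG i x := process_measurable hG i x.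
have Pfin X : measurable X -> P X \is a fin_num by move=> mX; exact: fin_num_measure.
(* The masses of the initial graphs already sum to 1, so nothing is left for [None]. *)
have PN : P [set w | G 0%N w = None] = 0%E.
  have mN := mG 0%N None; have mC := measurableC mN.
  have h1 : (\sum_(H : graph n) P [set w | G 0%N w = Some H] <=
      P (~` [set w | G 0%N w = None]))%E.
    apply: sum_measure_le => //; first exact: index_enum_uniq.
      by move=> H w /= ->.
    by move=> H H' w /= -> [].
  move: h1; under eq_bigr do rewrite (process_init hG).
  rewrite sumEFin sum_gnp_mass probability_setC //.
  have h0 : (0 <= P [set w | G 0%N w = None])%E by exact: measure_ge0.
  move: h0.
  have := Pfin _ mN; case: (P _) => // r _.
  rewrite -EFinB !lee_fin => h1 h2.
  by congr (_%:E); lra.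
have PC : (P (~` A) <= (\sum_(H | ~~ S H) gnp_mass p H + eps)%:E)%E.
  apply: (@le_trans _ _ (\sum_(s : option (graph n))
     P (if s is Some H then (if S H then
           [set w | G 0%N w = Some H] `&` fails (good H) 0 M
         else [set w | G 0%N w = Some H]) else [set w | G 0%N w = None]))%E).
    apply: measure_le_sum.
    - case=> [H|] //; case: ifP => _ //.
      by apply: measurableI => //; exact: measurable_fails.
    - exact: measurableC.
    - move=> w nA; exists (G 0%N w); first by rewrite mem_index_enum.
      case E : (G 0%N w) => [H|] //; case: ifP => // SH; split => //.
      apply: contrapT => nf; apply: nA; apply: (hA w H E) => i iM.
      by apply/negPn/negP => bi; apply: nf; exists i.
  rewrite (bigD1 None) //= PN add0e.
  rewrite (reindex_omap Some id) //=; last by case.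
  rewrite (eq_bigl predT); last by move=> H'; rewrite /= eqxx.
  apply: (@le_trans _ _ (\sum_(H : graph n)
    ((if S H then 0 else gnp_mass p H) + gnp_mass p H * eps)%:E)%E).
    apply: lee_sum => H _; case: ifP => SH; first by rewrite add0r hS.
    by rewrite (process_init hG) lee_fin lerDl mulr_ge0 ?gnp_mass_ge0.
  rewrite sumEFin lee_fin big_split /= -mulr_suml sum_gnp_mass mul1r lerD2r.
  by rewrite [leRHS]big_mkcond /=; apply: ler_sum => H _; case: (S H).
have mC : measurable (~` A) by exact: measurableC.
have := probability_setC P mA.
have := Pfin _ mA; have := Pfin _ mC; move: PC.
case: (P A) => // a; case: (P (~` A)) => // c.
rewrite !lee_fin => hc _ _ [ca]; move: hc; rewrite ca; lra.
Qed.

End Process.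

(** * One step of the clique removal process *)

Section CliqueHypergraph.
Variables (R : realType) (n k : nat).
Implicit Types (H : graph n) (K : {set 'I_n}).
Local Notation N := 'C(k, 2).
Local Notation NR := ('C(k, 2)%:R : R).
Local Notation x H := ((num_cliques k H)%:R : R).

Definition clique_degree H : edge n -> R := degree R (@edges_within n) (cliques k H).
Definition clique_var H : R := degree_var R (@edges_within n) N (cliques k H) H.
Definition clique_overlaps H : R := overlaps R (@edges_within n) (cliques k H).

Lemma cliques_card_edges H : {in cliques k H, forall K, #|edges_within K| = N}.
Proof. by move=> K; rewrite inE card_edges_within => /andP[/eqP ->]. Qed.

Lemma cliques_edges_sub H : {in cliques k H, forall K, edges_within K \subset H}.
Proof. by move=> K; rewrite inE => /andP[]. Qed.

Let hN := cliques_card_edges.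
Let hS := cliques_edges_sub.

Lemma cliques_subset H H' : H' \subset H -> cliques k H' \subset cliques k H.
Proof.
move=> s; apply/fintype.subsetP => K; rewrite !inE => /andP[-> /=] sK.
exact: fintype.subset_trans s.
Qed.

Lemma ler_sum_subset (I : finType) (A B : {set I}) (F : I -> R) :
  (forall i, 0 <= F i) -> A \subset B -> \sum_(i in A) F i <= \sum_(i in B) F i.
Proof.
move=> F0 sAB; rewrite [leRHS](bigID (mem A)) /= -[leLHS]addr0.
apply: lerD; last by apply: sumr_ge0.
rewrite le_eqVlt; apply/orP; left; apply/eqP; apply: eq_bigl => i.
by case: (boolP (i \in A)) => [/(fintype.subsetP sAB) ->|]; rewrite ?andbF.
Qed.

Lemma clique_degree_mono H H' e : H' \subset H -> clique_degree H' e <= clique_degree H e.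
Proof.
by move=> /cliques_subset s; apply: ler_sum_subset => // K; exact: inc_ge0.
Qed.

Lemma clique_overlaps_mono H H' : H' \subset H ->
  clique_overlaps H' <= clique_overlaps H.
Proof.
move=> /cliques_subset s; rewrite /clique_overlaps /overlaps.
apply: (@le_trans _ _ (\sum_(K in cliques k H') \sum_(K' in cliques k H)
    overlap R (@edges_within n) K K')).
  by apply: ler_sum => K _; apply: ler_sum_subset => // K'; exact: overlap_ge0.
by apply: ler_sum_subset => // K; apply: sumr_ge0 => K' _; exact: overlap_ge0.
Qed.

Lemma clique_var_ge0 H : 0 <= clique_var H.
Proof. by apply: sumr_ge0 => e _; exact: sqr_ge0. Qed.

Lemma clique_overlaps_ge0 H : 0 <= clique_overlaps H.
Proof. exact: overlaps_ge0. Qed.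

Lemma clique_degree_sqr_sum H : (0 < N)%N ->
  \sum_(e in H) clique_degree H e ^+ 2 = clique_var H + NR ^+ 2 / #|H|%:R * x H ^+ 2.
Proof. by move=> N0; rewrite /clique_var (degree_varE R (hN (H:=H)) (hS (H:=H)) N0) subrK. Qed.

Lemma num_cliques_remove H K : (num_cliques k (H :\: edges_within K))%:R =
  x H - \sum_(K' in cliques k H) hits_ind R (@edges_within n) K K'.
Proof. by rewrite /num_cliques cliques_remove card_survivors. Qed.

Section Step.
Variables (H : graph n) (Mq : R).
Hypothesis N4 : (4 <= N)%N.
Hypothesis x0 : (0 < num_cliques k H)%N.
Hypothesis hq : forall e, clique_degree H e <= Mq.
Let a := NR ^+ 2 / #|H|%:R.
Let h K := \sum_(K' in cliques k H) hits_ind R (@edges_within n) K K'.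
Let N0 : (0 < N)%N. Proof. exact: leq_trans N4. Qed.
Let a0 : 0 <= a. Proof. by rewrite divr_ge0 ?sqr_ge0. Qed.

Lemma sum_clique_var_remove :
  \sum_(K in cliques k H) clique_var (H :\: edges_within K) <=
  x H * ((1 + 18 * a) * clique_var H + 11 * a * clique_overlaps H).
Proof.
have := sum_degree_var_survivors_le R (hN (H:=H)) (hS (H:=H)) N4.
have -> : mean_degree R N (cliques k H) H * NR = x H * a.
  by rewrite /mean_degree /a /num_cliques; ring.
rewrite -/(clique_var H) -/(clique_overlaps H) -/(num_cliques k H) => h1.
apply: le_trans (_ : _ <= x H * clique_var H + x H * a *
   (18 * clique_var H + 11 * clique_overlaps H)) _; last by lra.
by apply: le_trans h1; under eq_bigr do rewrite /clique_var cliques_remove.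
Qed.

Let hits_sum_ge : a * x H ^+ 2 + clique_var H - clique_overlaps H <=
  \sum_(K in cliques k H) h K.
Proof.
have : \sum_(e in H) clique_degree H e ^+ 2 - clique_overlaps H <=
    \sum_(K in cliques k H) h K.
  exact: sum_hits_ge.
by rewrite clique_degree_sqr_sum // -/a; lra.
Qed.

Let hits_sum_le : \sum_(K in cliques k H) h K <= a * x H ^+ 2 + clique_var H.
Proof.
have : \sum_(K in cliques k H) h K <=
    \sum_(e in H) clique_degree H e ^+ 2.
  exact: sum_hits_le.
by rewrite clique_degree_sqr_sum // -/a; lra.
Qed.

Let h0 K : 0 <= h K.
Proof. by apply: sumr_ge0 => K' _; exact: hits_ge0. Qed.

Let hits_sqr_le : \sum_(K in cliques k H) h K ^+ 2 <=
  NR * Mq * (a * x H ^+ 2 + clique_var H).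
Proof.
have q0 (K : {set 'I_n}) : K \in cliques k H -> h K <= NR * Mq.
  move=> Kc; apply: (sum_hits_row_le (hN (H:=H)) (hS (H:=H)) Kc) => e _.
  exact: hq.
have B0 : 0 <= NR * Mq.
  move: x0; rewrite /num_cliques card_gt0 => /finset.set0Pn[K Kc].
  exact: le_trans (q0 K Kc).
apply: (@le_trans _ _ (NR * Mq * \sum_(K in cliques k H) h K)).
  rewrite mulr_sumr; apply: ler_sum => K Kc; rewrite expr2.
  by apply: ler_wpM2r => //; exact: q0.
exact: ler_wpM2l.
Qed.

(** Dividing by [Pi * (1 - a)] cancels the expected relative loss [a], so the scaled deviation [y]
    changes by [(a x - h K) / Pi']. The linear term is at most [2 (V + Dm)] per clique after
    scaling, since [2 |y| <= A <= 2 x / Pi]. The quadratic term uses [h K <= N Mq <= x] and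
    contributes one more [V], hence the coefficient 3. *)
Lemma sum_scaled_count_remove (Pi A rho abar Dm : R) :
  0 < rho -> rho <= Pi * (1 - a) -> Pi <= 1 -> a <= abar -> abar <= 1 / 2 ->
  0 < A -> 2 * (NR * Mq) <= A * rho -> clique_overlaps H <= Dm ->
  `|x H / Pi - A| <= A / 2 ->
  \sum_(K in cliques k H)
    ((num_cliques k (H :\: edges_within K))%:R / (Pi * (1 - a)) - A) ^+ 2 <=
  x H * ((x H / Pi - A) ^+ 2 + 3 / rho ^+ 2 * clique_var H +
    (2 * Dm + 4 * abar ^+ 2 * A ^+ 2 + 2 * abar * (NR * Mq) * A) / rho ^+ 2).
Proof.
move=> rho0 hrho Pi1 aab ab2 A0 hMq hD hy.
have a1 : 0 < 1 - a by lra.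
have Pi0 : 0 < Pi by rewrite -(pmulr_lgt0 _ a1); apply: lt_le_trans hrho.
have rP : rho <= Pi by have := mulr_ge0 (ltW Pi0) a0; lra.
have xx0 : 0 < x H by rewrite ltr0n.
set Pi' := Pi * (1 - a) in hrho *.
have Pi'0 : 0 < Pi' by exact: lt_le_trans hrho.
set y := x H / Pi - A in hy *.
have yE : x H = (y + A) * Pi by rewrite /y subrK mulfVK // gt_eqF.
have y1 : - (A / 2) <= y by move: hy; rewrite ler_norml => /andP[].
have y2 : y <= A / 2 by move: hy; rewrite ler_norml => /andP[].
have xge : A * Pi <= 2 * x H.
  have := ler_wpM2r (ltW Pi0) y1; rewrite yE; lra.
have xle : x H <= 2 * A.
  have := ler_wpM2r (ltW Pi0) y2; rewrite [x H]yE.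
  have := ler_wpM2l (ltW A0) Pi1; lra.
have termE K : (num_cliques k (H :\: edges_within K))%:R / Pi' - A =
    y + (a * x H - h K) / Pi'.
  rewrite num_cliques_remove -/(h K) /y /Pi'; field.
  by rewrite !gt_eqF.
under eq_bigr do rewrite termE.
clearbody y Pi'.
have hge := hits_sum_ge; have hle := hits_sum_le; have hsq := hits_sqr_le.
set s1 := \sum_(K in cliques k H) h K in hge hle.
set s2 := \sum_(K in cliques k H) h K ^+ 2 in hsq.
have e1 : \sum_(K in cliques k H) (y + (a * x H - h K) / Pi') ^+ 2 <=
   x H * y ^+ 2 + 2 * y / Pi' * (a * x H ^+ 2 - s1) +
   (a ^+ 2 * x H ^+ 3 + s2) / Pi' ^+ 2.
  have -> : x H * y ^+ 2 + 2 * y / Pi' * (a * x H ^+ 2 - s1) +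
      (a ^+ 2 * x H ^+ 3 + s2) / Pi' ^+ 2 =
      \sum_(K in cliques k H) (y ^+ 2 + 2 * y / Pi' * (a * x H - h K) +
        (a ^+ 2 * x H ^+ 2 + h K ^+ 2) / Pi' ^+ 2).
    have cst (c : R) : \sum_(K in cliques k H) c = x H * c.
      by rewrite sumr_const mulr_natl.
    have E2 (c : R) : \sum_(K in cliques k H) c * (a * x H - h K) =
        c * (a * x H ^+ 2 - s1).
      rewrite -[LHS]mulr_sumr sumrB cst; congr (c * (_ - _)).
      by rewrite expr2 mulrCA.
    have E3 (c : R) : \sum_(K in cliques k H) (a ^+ 2 * x H ^+ 2 + h K ^+ 2) * c =
        (a ^+ 2 * x H ^+ 3 + s2) * c.
      rewrite -[LHS]mulr_suml big_split cst; congr ((_ + _) * c).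
      by rewrite [x H ^+ 3]exprS mulrCA.
    by rewrite big_split /= E3 big_split /= E2 cst.
  apply: ler_sum => K _; rewrite sqrrD; apply: lerD.
    by rewrite lerD2l le_eqVlt; apply/orP; left; apply/eqP; ring.
  rewrite expr_div_n ler_pM2r ?invr_gt0 ?exprn_gt0 //.
  (* The cross term [- 2 a x h K] of the square is nonpositive and is dropped. *)
  have := mulr_ge0 (mulr_ge0 a0 (ltW xx0)) (h0 K); lra.
apply: le_trans e1 _.
have V0 := clique_var_ge0 H; have D0 := clique_overlaps_ge0 H.
set V := clique_var H in V0 hge hle hsq *.
set D := clique_overlaps H in D0 hD hge.
have irho : Pi'^-1 <= rho^-1 by rewrite lef_pV2 ?posrE.
have iPi : Pi^-1 <= rho^-1 by rewrite lef_pV2 ?posrE.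
have ir0 : 0 < rho^-1 by rewrite invr_gt0.
have iP0 : 0 < Pi'^-1 by rewrite invr_gt0.
have t1 : 2 * y / Pi' * (a * x H ^+ 2 - s1) <= x H * (2 * (V + Dm) / rho ^+ 2).
  apply: le_trans (ler_norm _) _.
  have n1 : `|a * x H ^+ 2 - s1| <= V + Dm by rewrite ler_norml; apply/andP; split; lra.
  have n2 : `|2 * y / Pi'| <= 2 * x H / rho ^+ 2.
    rewrite normrM (gtr0_norm iP0).
    have n3 : `|2 * y| <= 2 * x H / rho.
      rewrite normrM ger0_norm //.
      have : A <= 2 * x H / Pi by rewrite ler_pdivlMr.
      have : 2 * x H / Pi <= 2 * x H / rho.
        by apply: ler_wpM2l => //; rewrite mulr_ge0 // ltW.
      lra.
    have -> : 2 * x H / rho ^+ 2 = 2 * x H / rho / rho.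
      by rewrite expr2 invfM mulrA.
    by apply: ler_pM; rewrite // ltW.
  rewrite normrM; apply: le_trans (ler_pM _ _ n2 n1) _ => //.
  by rewrite le_eqVlt; apply/orP; left; apply/eqP; ring.
have NM0 : 0 <= NR * Mq.
  apply: mulr_ge0 => //.
  move: x0; rewrite /num_cliques card_gt0 => /finset.set0Pn[K Kc].
  have : (0 < #|edges_within K|)%N by rewrite (hN Kc).
  rewrite card_gt0 => /finset.set0Pn[e _]; apply: le_trans (hq e).
  exact: degree_ge0.
have NMx : NR * Mq <= x H.
  have := ler_wpM2l (ltW A0) rP; lra.
have t2 : a ^+ 2 * x H ^+ 3 + s2 <=
   x H * (V + 4 * abar ^+ 2 * A ^+ 2 + 2 * abar * (NR * Mq) * A).
  apply: le_trans (_ : _ <= a ^+ 2 * x H ^+ 3 + NR * Mq * (a * x H ^+ 2 + V)) _.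
    by rewrite lerD2l.
  have u1 : NR * Mq * V <= x H * V by exact: ler_wpM2r.
  have ax : a * x H <= abar * (2 * A).
    by apply: ler_pM => //; rewrite ltW.
  have ax0 : 0 <= a * x H by rewrite mulr_ge0 // ltW.
  have u2 : (a * x H) ^+ 2 <= (abar * (2 * A)) ^+ 2.
    by rewrite ler_sqr ?nnegrE //; apply: le_trans ax.
  have u3 := ler_wpM2l (ltW xx0) u2.
  have u4 := ler_wpM2l (ltW xx0) (ler_wpM2l NM0 ax).
  lra.
have t3 : (a ^+ 2 * x H ^+ 3 + s2) / Pi' ^+ 2 <=
   x H * (V + 4 * abar ^+ 2 * A ^+ 2 + 2 * abar * (NR * Mq) * A) / rho ^+ 2.
  apply: ler_pM => //.
  - apply: addr_ge0; last by apply: sumr_ge0 => K _; exact: sqr_ge0.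
    by rewrite mulr_ge0 ?sqr_ge0 ?exprn_ge0 // ltW.
  - by rewrite invr_ge0 sqr_ge0.
  - by rewrite lef_pV2 ?posrE ?exprn_gt0 // ler_sqr ?nnegrE // ltW.
apply: le_trans (lerD (lerD (lexx _) t1) t3) _.
by rewrite le_eqVlt; apply/orP; left; apply/eqP; ring.
Qed.

End Step.
End CliqueHypergraph.

(** * The tracking potential *)

Section Tracking.
Local Open Scope classical_set_scope.
Variables (R : realType) (n k : nat) (p : R) (d : measure_display).
Variables (T : measurableType d) (P : probability T R).
Variables (G : nat -> T -> option (graph n)).
Hypothesis hG : clique_removal_process k p P G.
Local Notation N := 'C(k, 2).
Local Notation NR := ('C(k, 2)%:R : R).
Local Notation x H := ((num_cliques k H)%:R : R).
Variables (e0 M : nat) (A abar Mq Dm rho lam : R) (g : nat -> R).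

Let rate i : R := NR ^+ 2 / (e0%:R - i%:R * NR).
Let decay m : R := \prod_(0 <= i < m) (1 - rate i).

Hypothesis N4 : (4 <= N)%N.
Hypothesis rho0 : 0 < rho.
Hypothesis rho_le : forall m, (m <= M)%N -> rho <= decay m.
Hypothesis edges_gt0 : forall i, (i < M)%N -> 0 < e0%:R - i%:R * NR :> R.
Hypothesis rate_le : forall i, (i < M)%N -> rate i <= abar.
Hypothesis abar0 : 0 <= abar.
Hypothesis abar2 : abar <= 1 / 2.
Hypothesis A0 : 0 < A.
Hypothesis hMq : 2 * (NR * Mq) <= A * rho.
Hypothesis Mq0 : 0 <= Mq.
Hypothesis Dm0 : 0 <= Dm.
Hypothesis g2 : forall m, (m <= M)%N -> g m <= 1 / 2.
Hypothesis lam0 : 0 < lam.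
Hypothesis lam_le : forall m, (m <= M)%N -> lam <= g m * A.

Definition count_good m (H : graph n) : bool :=
  x H \in `[A * decay m * (1 - g m), A * decay m * (1 + g m)]%R.

(** The number of edges is deterministic, and overlaps and degrees can only decrease, so bounds that
    hold for the initial graph persist. The variance may grow and is therefore put into the
    potential. *)
Definition tracking_inv m (H : graph n) : Prop :=
  [/\ #|H|%:R = e0%:R - m%:R * NR :> R, clique_overlaps R k H <= Dm
    & forall e, clique_degree R k H e <= Mq].

Let kap : R := (2 * Dm + 4 * abar ^+ 2 * A ^+ 2 + 2 * abar * (NR * Mq) * A) / rho ^+ 2.
Let r : R := 1 + 18 * abar.

(* [V / r^m] increases by at most [11 abar Dm] per step on average, and [3 V / rho^2]
   bounds the part of the drift of the square that is not already in [kap]. *)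
Definition tracking_potential m (H : graph n) : R :=
  ((x H / decay m - A) ^+ 2 + (M%:R - m%:R) * (kap + 3 / rho ^+ 2 * r ^+ M *
    (clique_var R k H / r ^+ m + 11 * abar * Dm * (M%:R - m%:R)))) / lam ^+ 2.

Let decay_gt0 m : (m <= M)%N -> 0 < decay m.
Proof. by move=> mM; exact: lt_le_trans (rho_le mM). Qed.

Let r1 : 1 <= r. Proof. by rewrite /r; move: abar0; lra. Qed.
Let r0 : 0 < r. Proof. by apply: lt_le_trans r1. Qed.
Let kap0 : 0 <= kap.
Proof.
rewrite /kap divr_ge0 ?sqr_ge0 // !addr_ge0 // !mulr_ge0 ?sqr_ge0 //; exact: ltW.
Qed.

Let rate_ge0 i : (i < M)%N -> 0 <= rate i.
Proof. by move=> iM; rewrite divr_ge0 ?sqr_ge0 // ltW // edges_gt0. Qed.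

Let decay_le1 m : (m <= M)%N -> decay m <= 1.
Proof.
elim: m => [|m IHm] mM; first by rewrite /decay big_nil.
rewrite /decay big_nat_recr //= -/(decay m).
have h1 := IHm (ltnW mM); have h2 := rate_ge0 mM; have h3 := rate_le mM.
have h4 := decay_gt0 (ltnW mM).
apply: le_trans (_ : decay m * 1 <= _); last by rewrite mulr1.
by apply: ler_wpM2l; [exact: ltW|lra].
Qed.

Lemma count_goodE m H : (m <= M)%N ->
  count_good m H = (`|x H / decay m - A| <= g m * A).
Proof.
move=> mM; have c0 := decay_gt0 mM.
rewrite /count_good in_itv /= ler_norml lerBrDr lerBlDr.
rewrite ler_pdivlMr // ler_pdivrMr //.
by congr (_ && _); congr (_ <= _); ring.
Qed.

Let tail_ge0 m (H : graph n) : (m <= M)%N -> 0 <= (M%:R - m%:R) * (kap + 3 / rho ^+ 2 * r ^+ M *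
    (clique_var R k H / r ^+ m + 11 * abar * Dm * (M%:R - m%:R))).
Proof.
move=> mM; have j0 : 0 <= M%:R - m%:R :> R by rewrite subr_ge0 ler_nat.
have V0 := clique_var_ge0 R k H; have rr i : 0 <= r ^+ i by rewrite exprn_ge0 // ltW.
apply: mulr_ge0 => //; apply: addr_ge0 => //; apply: mulr_ge0.
  by rewrite mulr_ge0 // divr_ge0 ?sqr_ge0.
by rewrite addr_ge0 // ?divr_ge0 // !mulr_ge0.
Qed.

Lemma tracking_potential_ge0 m H : (m <= M)%N -> 0 <= tracking_potential m H.
Proof.
by move=> mM; rewrite divr_ge0 ?sqr_ge0 // addr_ge0 ?sqr_ge0 // tail_ge0.
Qed.

Lemma initial_tracking_fails_le H : tracking_inv 0 H ->
  (P ([set w | G 0%N w = Some H] `&` fails G count_good 0 M) <=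
   (gnp_mass p H * tracking_potential 0 H)%:E)%E.
Proof.
apply: (initial_fails_le hG (I := tracking_inv)) => {H}.
- by move=> m H mM; exact: tracking_potential_ge0.
- move=> m H mM _; rewrite count_goodE // -ltNge => hy.
  rewrite /tracking_potential ler_pdivlMr ?exprn_gt0 // mul1r.
  rewrite -[leLHS]addr0; apply: lerD; last exact: tail_ge0.
  rewrite -[leRHS]real_normK ?num_real //.
  rewrite ler_sqr ?nnegrE //; last exact: ltW.
  by apply: ltW; apply: le_lt_trans hy; exact: lam_le.
- move=> m H K mM [He HD Hq] _ Kc; split.
  + have sK := cliques_edges_sub Kc; have cK := cliques_card_edges Kc.
    rewrite finset.cardsDS // cK natrB; last by rewrite -cK subset_leq_card.
    by rewrite He -natr1; ring.
  + by apply: le_trans HD; apply: clique_overlaps_mono; rewrite finset.subsetDl.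
  + move=> e; apply: le_trans (Hq e); apply: clique_degree_mono.
    by rewrite finset.subsetDl.
- move=> m H mM _; rewrite /count_good in_itv /= => /andP[h _].
  rewrite -(ltr0n R); apply: lt_le_trans h.
  have := g2 (ltnW mM); have := decay_gt0 (ltnW mM) => c0 gm.
  by rewrite !mulr_gt0 //; lra.
- move=> m H mM [He HD Hq] gH.
  have x0 : (0 < num_cliques k H)%N.
    move: gH; rewrite /count_good in_itv /= => /andP[h _].
    rewrite -(ltr0n R); apply: lt_le_trans h.
    have := g2 (ltnW mM); have := decay_gt0 (ltnW mM) => c0 gm.
    by rewrite !mulr_gt0 //; lra.
  have aE : NR ^+ 2 / #|H|%:R = rate m by rewrite He.
  have dE : decay m.+1 = decay m * (1 - rate m) by rewrite /decay big_nat_recr.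
  have hy : `|x H / decay m - A| <= A / 2.
    move: gH; rewrite count_goodE; last exact: ltnW.
    move=> /le_trans; apply; have := ler_wpM2r (ltW A0) (g2 (ltnW mM)); lra.
  have s1 := @sum_scaled_count_remove R n k H Mq N4 x0 Hq (decay m) A rho abar Dm rho0.
  rewrite aE -dE in s1.
  have {}s1 := s1 (rho_le mM) (decay_le1 (ltnW mM)) (rate_le mM) abar2 A0 hMq HD hy.
  have s2 := @sum_clique_var_remove R n k H N4.
  rewrite aE in s2.
  have V0 := clique_var_ge0 R k H; have D0 := clique_overlaps_ge0 R k H.
  have ra := rate_le mM; have ra0 := rate_ge0 mM.
  have {}s2 : \sum_(K in cliques k H) clique_var R k (H :\: edges_within K) <=
      x H * (r * clique_var R k H + 11 * abar * Dm).
    apply: le_trans s2 _; apply: ler_wpM2l => //; apply: lerD.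
      by apply: ler_wpM2r => //; rewrite /r; lra.
    apply: ler_pM => //; last by lra.
    by rewrite mulr_ge0.
  rewrite /tracking_potential -mulr_suml mulrA ler_pM2r ?invr_gt0 ?exprn_gt0 //.
  rewrite -/kap in s1.
  rewrite big_split /= -mulr_sumr.
  pose c : R := 3 / rho ^+ 2 * r ^+ M.
  have c0 : 0 <= c.
    by rewrite /c mulr_ge0 ?exprn_ge0 ?ltW // divr_gt0 // exprn_gt0.
  (* The bracket occurs [j + 1] times at time [m] and [j] times afterwards. By [s3] the [j] copies
     do not grow on average, and the extra copy pays for the drift of the square in [s1], its
     variance part by [s4]. *)
  pose j : R := M%:R - m.+1%:R.
  have j0 : 0 <= j by rewrite subr_ge0 ler_nat.
  have jE : M%:R - m%:R = j + 1 :> R by rewrite /j -natr1; ring.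
  rewrite -/j jE -/c.
  have s3 : \sum_(K in cliques k H) (kap + c *
        (clique_var R k (H :\: edges_within K) / r ^+ m.+1 + 11 * abar * Dm * j)) <=
      x H * (kap + c * (clique_var R k H / r ^+ m + 11 * abar * Dm * (j + 1))).
    have cst (b : R) : \sum_(K in cliques k H) b = x H * b.
      by rewrite sumr_const mulr_natl.
    rewrite big_split /= cst -mulr_sumr big_split /= cst -mulr_suml [leRHS]mulrDr lerD2l.
    rewrite [leRHS]mulrCA; apply: ler_wpM2l => //.
    apply: le_trans (_ : _ <= x H * (r * clique_var R k H + 11 * abar * Dm) / r ^+ m.+1
      + x H * (11 * abar * Dm * j)) _.
      by rewrite lerD2r ler_wpM2r // invr_ge0 exprn_ge0 // ltW.
    rewrite -mulrA -mulrDr; apply: ler_wpM2l => //.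
    have -> : (r * clique_var R k H + 11 * abar * Dm) / r ^+ m.+1 =
        clique_var R k H / r ^+ m + 11 * abar * Dm / r ^+ m.+1.
      by rewrite exprS; field; rewrite gt_eqF ?exprn_gt0 // gt_eqF.
    have : 11 * abar * Dm / r ^+ m.+1 <= 11 * abar * Dm.
      by rewrite ler_piMr ?mulr_ge0 // invf_le1 ?exprn_gt0 // exprn_ege1.
    lra.
  have s4 : 3 / rho ^+ 2 * clique_var R k H <= c * (clique_var R k H / r ^+ m).
    rewrite /c -[leRHS]mulrA; apply: ler_wpM2l; first by rewrite ltW // divr_gt0 // exprn_gt0.
    rewrite mulrCA ler_peMr // ler_pdivlMr ?exprn_gt0 // mul1r.
    by apply: ler_weXn2l => //; exact: ltnW.
  have s5 := ler_wpM2l j0 s3.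
  have s6 := ler_wpM2l (ler0n R (num_cliques k H)) s4.
  have s7 : 0 <= x H * (c * (11 * abar * Dm * (j + 1))).
    by repeat first [done | apply: mulr_ge0 | apply: addr_ge0].
  apply: le_trans (lerD s1 s5) _.
  move: s6 s7; set w := clique_var R k H / r ^+ m.
  set u := 3 / rho ^+ 2 * clique_var R k H; set t := 11 * abar * Dm * (j + 1).
  set y2 := (x H / decay m - A) ^+ 2; set X := x H; set kp := kap.
  clear s1 s2 s3 s4 s5; clearbody w u t y2 X kp c j; lra.
Qed.

End Tracking.

(** * Moments of clique statistics in G(n, p) *)

Section Moments.
Variables (R : realType) (n k : nat) (p : R).
Hypotheses (n2 : (2 <= n)%N) (k2 : (2 <= k)%N) (p0 : 0 < p) (p1 : p <= 1).
Local Notation N := 'C(k, 2).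
Local Notation NR := ('C(k, 2)%:R : R).
Local Notation C2 := ('C(n, 2)%:R : R).
Local Notation E := (@edges_within n).
Local Notation A := (expected_cliques p n k).
Local Notation x H := ((num_cliques k H)%:R : R).
Implicit Types (H : graph n) (K : {set 'I_n}).

Definition ksets : {set {set 'I_n}} := [set K : {set 'I_n} | #|K| == k]%SET.
Definition shared K K' : nat := #|E K :&: E K'|.
Definition pair_overlaps : R :=
  \sum_(K in ksets) \sum_(K' in ksets) overlap R E K K' * p ^+ (N + N - shared K K').

Let p01 : 0 <= p <= 1. Proof. by rewrite p1 ltW. Qed.
Let C20 : 0 < C2. Proof. by rewrite ltr0n bin_gt0. Qed.
Let N0 : (0 < N)%N. Proof. by rewrite bin_gt0. Qed.

Lemma card_ksets : #|ksets| = 'C(n, k).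
Proof. by rewrite card_draws card_ord. Qed.

Lemma ksets_card_edges : {in ksets, forall K, #|E K| = N}.
Proof. by move=> K; rewrite inE card_edges_within => /eqP ->. Qed.

Lemma sum_cliquesE H (F : {set 'I_n} -> R) :
  \sum_(K in cliques k H) F K = \sum_(K in ksets) (E K \subset H)%:R * F K.
Proof.
rewrite [LHS](eq_bigl (fun K => (K \in ksets) && (E K \subset H))); last first.
  by move=> K; rewrite !inE.
by rewrite big_mkcondr; apply: eq_bigr => K _; case: ifP; rewrite ?mul1r ?mul0r.
Qed.

Lemma gnp_mean_cliques : gnp_mean p (fun H => x H) = A.
Proof.
transitivity (gnp_mean p (fun H => \sum_(K in ksets) (E K \subset H)%:R)).
  apply: eq_gnp_mean => H; rewrite /num_cliques -sum1_card natr_sum sum_cliquesE.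
  by apply: eq_bigr => K _; rewrite mulr1.
rewrite gnp_mean_sum (eq_bigr (fun=> p ^+ N)); last first.
  by move=> K Kk; rewrite gnp_mean_sub ksets_card_edges.
by rewrite sumr_const card_ksets /expected_cliques mulr_natl.
Qed.

Lemma gnp_mean_clique_pairs (F : {set 'I_n} -> {set 'I_n} -> R) :
  gnp_mean p (fun H => \sum_(K in cliques k H) \sum_(K' in cliques k H) F K K') =
  \sum_(K in ksets) \sum_(K' in ksets) F K K' * p ^+ (N + N - shared K K').
Proof.
transitivity (gnp_mean p (fun H => \sum_(K in ksets) \sum_(K' in ksets)
   F K K' * (E K :|: E K' \subset H)%:R)).
  apply: eq_gnp_mean => H; rewrite sum_cliquesE; apply: eq_bigr => K _.
  rewrite sum_cliquesE mulr_sumr; apply: eq_bigr => K' _.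
  by rewrite finset.subUset -mulnb natrM; ring.
rewrite gnp_mean_sum; apply: eq_bigr => K Kk.
rewrite gnp_mean_sum; apply: eq_bigr => K' Kk'.
by rewrite gnp_meanZ gnp_mean_sub cardsU !ksets_card_edges.
Qed.

Lemma gnp_mean_overlaps : gnp_mean p (clique_overlaps R k (n:=n)) = pair_overlaps.
Proof. exact: gnp_mean_clique_pairs. Qed.

Lemma degree_ksets (e : edge n) : degree R E ksets e = 'C(n - 2, k - 2)%:R.
Proof.
have e2 : #|val e| = 2 by apply/eqP; exact: (valP e).
have -> : degree R E ksets e = #|[set K in ksets | e \in E K]%SET|%:R.
  rewrite /degree -sum1_card natr_sum big_mkcond [RHS]big_mkcond.
  apply: eq_bigr => K _; rewrite [K \in [set _ in _ | _]%SET]inE /incidence.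
  by case: (K \in ksets); case: (e \in E K).
congr (_%:R).
have -> : [set K in ksets | e \in E K]%SET =
   [set val e :|: B | B in [set B : {set 'I_n} | B \subset ~: val e & #|B| == (k - 2)%N]%SET]%SET.
  apply/setP => K; rewrite !inE; apply/andP/imsetP => [[/eqP Kk eK]|[B]].
    exists (K :\: val e); last first.
      apply/setP => v; rewrite !inE; case: (boolP (v \in val e)) => //=.
      by move/(fintype.subsetP eK) ->.
    rewrite inE finset.setDE finset.subsetIr /= -finset.setDE finset.cardsDS //.
    by rewrite Kk e2.
  rewrite inE => /andP[Be /eqP Bk] ->; split; last by rewrite finset.subsetUl.
  rewrite cardsU e2 Bk (_ : _ :&: _ = finset.set0) ?cards0 ?subn0 ?subnKC //.
  by apply: disjoint_setI0; rewrite disjoint_sym finset.disjoints_subset.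
rewrite card_in_imset; last first.
  move=> B B'; rewrite !inE => /andP[Be _] /andP[Be' _] eq.
  have h (X : {set 'I_n}) : X \subset ~: val e -> X = (val e :|: X) :\: val e.
    rewrite -finset.disjoints_subset => dX.
    by rewrite finset.setDUl finset.setDv finset.set0U; apply/esym/finset.setDidPl.
  by rewrite (h B Be) (h B' Be') eq.
by rewrite cards_draws cardsCs finset.setCK e2 card_ord.
Qed.

(** In the complete graph every edge lies in the same number [c] of k-sets, so the sum of squared
    degrees is [C2 * c ^+ 2], and counting incidences gives [C2 * c]. *)
Lemma sum_shared : \sum_(K in ksets) \sum_(K' in ksets) (shared K K')%:R =
  NR ^+ 2 * 'C(n, k)%:R ^+ 2 / C2 :> R.
Proof.
have sT : {in ksets, forall K, E K \subset [set: edge n]%SET}.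
  by move=> K _; exact: finset.subsetT.
have := sum_degree_sqr R sT; rewrite /meet_size => <-.
pose c : R := 'C(n - 2, k - 2)%:R.
have h : C2 * c = NR * 'C(n, k)%:R.
  rewrite -card_ksets -(sum_degree R ksets_card_edges sT).
  rewrite (eq_bigr (fun=> c)); last by move=> e _; exact: degree_ksets.
  by rewrite sumr_const cardsT card_edge mulr_natl.
rewrite (eq_bigr (fun=> c ^+ 2)); last by move=> e _; rewrite degree_ksets.
rewrite sumr_const cardsT card_edge -[c ^+ 2 *+ _]mulr_natl.
have -> : NR ^+ 2 * 'C(n, k)%:R ^+ 2 = (C2 * c) ^+ 2.
  by rewrite h; ring.
by field; rewrite gt_eqF.
Qed.

Let shared_le K K' : K \in ksets -> (shared K K' <= N)%N.
Proof.
by move=> Kk; rewrite -(ksets_card_edges Kk) subset_leq_card // finset.subsetIl.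
Qed.

(** The three terms are meant for pairs with no common edge, exactly one, and at least two. Using
    the number of common edges in the middle term, instead of an indicator, makes its sum exact. *)
Let sum_shared_le (F : {set 'I_n} -> {set 'I_n} -> R) c :
  (forall K K', K \in ksets ->
     F K K' <= c + (shared K K')%:R * p ^+ (N + N - 1) +
      overlap R E K K' * p ^+ (N + N - shared K K')) ->
  \sum_(K in ksets) \sum_(K' in ksets) F K K' <=
  'C(n, k)%:R ^+ 2 * c + NR ^+ 2 / (C2 * p) * A ^+ 2 + pair_overlaps.
Proof.
move=> hF; apply: le_trans (_ : _ <= \sum_(K in ksets) \sum_(K' in ksets)
  (c + (shared K K')%:R * p ^+ (N + N - 1) +
      overlap R E K K' * p ^+ (N + N - shared K K'))) _.
  by apply: ler_sum => K Kk; apply: ler_sum => K' _; exact: hF.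
under eq_bigr do rewrite !big_split /= -mulr_suml.
rewrite !big_split /= -mulr_suml sum_shared -/pair_overlaps.
under eq_bigr do rewrite sumr_const card_ksets -mulr_natl.
rewrite sumr_const card_ksets -mulr_natl lerD2r le_eqVlt; apply/orP; left; apply/eqP.
congr (_ + _); first by ring.
rewrite /expected_cliques.
have -> : (N + N - 1 = N.-1 + N)%N by rewrite addnC -addnBA ?subn1 // addnC.
have -> : p ^+ N = p * p ^+ N.-1 by rewrite -exprS prednK.
rewrite exprD; have -> : p ^+ N = p * p ^+ N.-1 by rewrite -exprS prednK.
by field; rewrite !gt_eqF.
Qed.

Let overlap_expr K K' : overlap R E K K' =
  if (1 < shared K K')%N then (shared K K')%:R ^+ 2 else 0.
Proof. by []. Qed.

(** The choice [c = p^(2N)] for the edge-disjoint pairs reproduces [A^2], which the square of the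
    mean cancels. *)
Lemma gnp_cliques_var theta : pair_overlaps <= theta * A ^+ 2 ->
  gnp_mean p (fun H => (x H - A) ^+ 2) <= (NR ^+ 2 / (C2 * p) + theta) * A ^+ 2.
Proof.
move=> hth.
have -> : gnp_mean p (fun H => (x H - A) ^+ 2) =
    gnp_mean p (fun H => x H ^+ 2 + (- (2 * A) * x H + A ^+ 2)).
  by apply: eq_gnp_mean => H; ring.
rewrite !gnp_meanD gnp_meanZ gnp_mean_cliques gnp_mean_cst.
have -> : gnp_mean p (fun H => x H ^+ 2) =
    gnp_mean p (fun H => \sum_(K in cliques k H) \sum_(K' in cliques k H) 1).
  by apply: eq_gnp_mean => H; rewrite sumr_const sumr_const -mulrnA natrM expr2.
rewrite gnp_mean_clique_pairs.
have h := @sum_shared_le (fun K K' => 1 * p ^+ (N + N - shared K K')) (p ^+ (N + N)) _.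
have {h}h : _ := h _.
apply: le_trans (lerD (h _) (lexx _)) _; last first.
  have -> : 'C(n, k)%:R ^+ 2 * p ^+ (N + N) = A ^+ 2.
    by rewrite /expected_cliques exprD; ring.
  lra.
move=> K K' Kk; rewrite overlap_expr mul1r; have := shared_le K' Kk.
have pp i : 0 <= p ^+ i by rewrite exprn_ge0 // ltW.
case: (shared K K') => [|[|s]] sN /=; rewrite ?subn0 ?mul0r ?mul1r ?addr0 //.
  by rewrite lerDr.
apply: le_trans (_ : s.+2%:R ^+ 2 * p ^+ (N + N - s.+2) <= _).
  by rewrite ler_peMl // exprn_ege1 // ler1n.
by rewrite lerDr addr_ge0 // mulr_ge0.
Qed.

(** The centre [c] is the mean degree with [Q] and [e(G)] replaced by their expectations. The pairs
    with one common edge contribute [N^2 A^2 / (C2 p)], exactly what the centring subtracts, so only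
    the overlaps remain. *)
Lemma gnp_clique_var theta : pair_overlaps <= theta * A ^+ 2 ->
  gnp_mean p (clique_var R k (n:=n)) <= theta * A ^+ 2.
Proof.
move=> hth; pose c := NR * A / (C2 * p).
apply: le_trans (_ : _ <= gnp_mean p (fun H =>
   \sum_(K in cliques k H) \sum_(K' in cliques k H) meet_size R E K K' +
   (- (2 * c * NR) * x H + c ^+ 2 * #|H|%:R))) _.
  apply: ler_gnp_mean => // H.
  have hN := @cliques_card_edges n k H; have hS := @cliques_edges_sub n k H.
  apply: le_trans (degree_var_le hN hS c N0) _.
  rewrite -(sum_degree_sqr R hS) le_eqVlt; apply/orP; left; apply/eqP.
  have <- : c ^+ 2 *+ #|H| = c ^+ 2 * #|H|%:R by rewrite mulr_natr.
  rewrite -[_ *+ #|H|]sumr_const.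
  have -> : - (2 * c * NR) * x H = \sum_(e in H) - (2 * c) * degree R E (cliques k H) e.
    by rewrite -mulr_sumr (sum_degree R hN hS) /num_cliques; ring.
  by rewrite -!big_split /=; apply: eq_bigr => e _; ring.
rewrite !gnp_meanD !gnp_meanZ gnp_mean_cliques gnp_mean_card gnp_mean_clique_pairs.
have h := @sum_shared_le (fun K K' => meet_size R E K K' * p ^+ (N + N - shared K K')) 0 _.
apply: le_trans (lerD (h _) (lexx _)) _.
  move=> K K' Kk; rewrite overlap_expr add0r /meet_size -/(shared K K').
  have pp i : 0 <= p ^+ i by rewrite exprn_ge0 // ltW.
  case: (shared K K') => [|[|s]] /=; rewrite ?mul0r ?mul1r ?addr0 //.
  apply: le_trans (_ : s.+2%:R ^+ 2 * p ^+ (N + N - s.+2) <= _).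
    by rewrite ler_wpM2r // expr2 ler_peMr // ler1n.
  by rewrite lerDr mulr_ge0.
have -> : - (2 * c * NR) * A + c ^+ 2 * (C2 * p) = - (NR ^+ 2 / (C2 * p) * A ^+ 2).
  by rewrite /c; field; rewrite !gt_eqF.
lra.
Qed.

End Moments.

(** * Overlapping pairs of cliques *)

Lemma bin_le_expn m j : ('C(m, j) <= m ^ j)%N.
Proof.
have h : (m ^_ j <= m ^ j)%N.
  elim: j m => [|j IHj] [|m] //; rewrite ffactSS expnS leq_mul //.
  by apply: leq_trans (IHj m) _; case: j {IHj} => // j; rewrite leq_exp2r.
by apply: leq_trans h; rewrite -bin_ffact leq_pmulr // fact_gt0.
Qed.

(** Iterates [(n - m) C(n, m) = (m + 1) C(n, m + 1)] with [m + 1 <= k] and [n - m >= n - k]. *)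
Lemma bin_down_le n k j : (j <= k)%N -> (k <= n)%N ->
  ('C(n, k - j) * (n - k) ^ j <= k ^ j * 'C(n, k))%N.
Proof.
move=> + kn; elim: j => [|j IHj] jk; first by rewrite subn0 !expn0 muln1 mul1n.
have {IHj} := IHj (ltnW jk).
have -> : (k - j = (k - j.+1).+1)%N by rewrite subnSK.
set m := (k - j.+1)%N => h.
have mk : (m < k)%N by rewrite /m; lia.
rewrite !expnS mulnA.
have h1 : ('C(n, m) * (n - k) <= k * 'C(n, m.+1))%N.
  apply: (@leq_trans ('C(n, m) * (n - m))).
    by rewrite leq_mul2l leq_sub2l ?orbT // ltnW.
  by rewrite mulnC -mul_bin_left leq_mul2r mk orbT.
apply: leq_trans (leq_mul h1 (leqnn _)) _.
by rewrite -!mulnA leq_mul2l h orbT.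
Qed.

Lemma leq_double_sub n k : (2 * k <= n)%N -> (n <= 2 * (n - k))%N.
Proof. lia. Qed.

Section PairOverlaps.
Variables (R : realType) (n k : nat) (p : R).
Hypotheses (p0 : 0 < p).
Local Notation N := 'C(k, 2).
Local Notation A := (expected_cliques p n k).

Lemma card_ksets_meet (K : {set 'I_n}) j : K \in ksets n k ->
  (#|[set K' in ksets n k | #|K :&: K'| == j]%SET| <= 'C(k, j) * 'C(n, k - j))%N.
Proof.
rewrite inE => /eqP Kk.
pose f (K' : {set 'I_n}) := (K :&: K', K' :\: K).
have fi : injective f.
  by move=> X Y [e1 e2]; rewrite -(finset.setID X K) -(finset.setID Y K)
    ![_ :&: K]finset.setIC e1 e2.
have h1 := cards_draws K j; have h2 := card_draws 'I_n (k - j)%N.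
rewrite Kk in h1; rewrite card_ord in h2.
rewrite -(card_imset _ fi) -h1 -h2 -cardsX; apply: subset_leq_card; apply/fintype.subsetP => Z.
case/imsetP => K'; rewrite !inE => /andP[/eqP K'k /eqP jj] -> /=.
rewrite finset.subsetIl jj eqxx /=.
have := cardsID K K'; rewrite finset.setIC jj K'k => <-.
by rewrite addKn.
Qed.

(** Two k-sets with [j] common vertices share [C(j, 2)] edges, so only [j >= 3] counts. The factor
    [k] is for the values of [j], and the squared binomial bounds the weight of an overlap. *)
Lemma pair_overlaps_le (tau : R) : 0 <= tau ->
  (forall j, (3 <= j <= k)%N ->
    'C(k, j)%:R * 'C(n, k - j)%:R <= tau * ('C(n, k)%:R * p ^+ 'C(j, 2))) ->
  pair_overlaps n k p <= k%:R * 'C(k, 2)%:R ^+ 2 * tau * A ^+ 2.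
Proof.
move=> tau0 htau; rewrite /pair_overlaps.
pose B : R := k%:R * (N%:R ^+ 2 * (tau * ('C(n, k)%:R * p ^+ (N + N)))).
have -> : k%:R * N%:R ^+ 2 * tau * A ^+ 2 = \sum_(K in ksets n k) B.
  rewrite sumr_const card_ksets -mulr_natl /B /expected_cliques exprD; ring.
apply: ler_sum => K Kk.
have jle (K' : {set 'I_n}) : (#|K :&: K'| < k.+1)%N.
  by move: Kk; rewrite inE ltnS => /eqP <-; rewrite subset_leq_card // finset.subsetIl.
rewrite (partition_big (fun K' : {set 'I_n} => Ordinal (jle K')) predT) //=.
rewrite big_ord_recl /= big1 ?add0r; last first.
  move=> K' /andP[_ /eqP/(congr1 val) /= jj].
  by rewrite /overlap edges_withinI card_edges_within jj mul0r.
rewrite /B; have -> : k%:R *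
    (N%:R ^+ 2 * (tau * ('C(n, k)%:R * p ^+ (N + N)))) =
  \sum_(j < k) (N%:R ^+ 2 * (tau * ('C(n, k)%:R * p ^+ (N + N)))) :> R.
  by rewrite sumr_const card_ord mulr_natl.
apply: ler_sum => i _; set j := bump 0 i.
have jk : (j <= k)%N by rewrite /j /bump add1n.
have pp m : 0 <= p ^+ m by rewrite exprn_ge0 // ltW.
have jN : ('C(j, 2) <= N)%N by rewrite leq_bin2l.
have [j3|j3] := leqP 3 j; last first.
  rewrite big1; first by rewrite !mulr_ge0 ?sqr_ge0.
  move=> K' /andP[_ /eqP/(congr1 val) /= jj].
  rewrite /overlap edges_withinI card_edges_within jj -/j.
  by move: j3; case: (j) => [|[|[|]]] //= _; rewrite mul0r.
rewrite (eq_bigr (fun=> 'C(j, 2)%:R ^+ 2 * p ^+ (N + N - 'C(j, 2)))); last first.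
  move=> K' /andP[_ /eqP/(congr1 val) /= jj].
  rewrite /overlap /shared /meet_size edges_withinI card_edges_within jj -/j.
  have -> // : (1 < 'C(j, 2))%N.
  by apply: leq_trans (leq_bin2l 2 j3).
rewrite sumr_const -[leLHS]mulr_natl.
have c1 : (#|[pred K' : {set 'I_n} | (K' \in ksets n k) && (Ordinal (jle K') == lift ord0 i)]|
    <= 'C(k, j) * 'C(n, k - j))%N.
  apply: leq_trans (card_ksets_meet j Kk); apply: subset_leq_card.
  apply/fintype.subsetP => K'; rewrite !inE => /andP[-> /eqP/(congr1 val) /= ->].
  by rewrite eqxx.
apply: (@le_trans _ _ (('C(k, j) * 'C(n, k - j))%:R *
   ('C(j, 2)%:R ^+ 2 * p ^+ (N + N - 'C(j, 2))))).
  by apply: ler_wpM2r; rewrite ?mulr_ge0 ?sqr_ge0 // ler_nat.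
have h := htau j; rewrite j3 jk in h.
apply: (@le_trans _ _ (tau * ('C(n, k)%:R * p ^+ 'C(j, 2)) *
   ('C(j, 2)%:R ^+ 2 * p ^+ (N + N - 'C(j, 2))))).
  by rewrite natrM; apply: ler_wpM2r; rewrite ?mulr_ge0 ?sqr_ge0 // h.
have -> : tau * ('C(n, k)%:R * p ^+ 'C(j, 2)) *
   ('C(j, 2)%:R ^+ 2 * p ^+ (N + N - 'C(j, 2))) =
   'C(j, 2)%:R ^+ 2 * (tau * ('C(n, k)%:R * (p ^+ 'C(j, 2) * p ^+ (N + N - 'C(j, 2))))).
  by ring.
rewrite -exprD subnKC; last by rewrite (leq_trans jN) // leq_addr.
apply: ler_wpM2r; first by rewrite !mulr_ge0.
by rewrite ler_sqr ?nnegrE // ler_nat.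
Qed.

Lemma natr_bin2 (m : nat) : 'C(m, 2)%:R = m%:R * (m%:R - 1) / 2 :> R.
Proof.
case: m => [|m]; first by rewrite mul0r mul0r.
have := congr1 (fun i => i%:R : R) (mul_bin_left m.+1 1).
have e : m.+1%:R = m%:R + 1 :> R by rewrite natr1.
by rewrite /= bin1 subn1 !natrM /= e; lra.
Qed.

(* With [b = ln (1/p)]: if [(j-1) b <= 7/4 ln n] then ['C(n, k-j) / 'C(n, k) <= (2k/n)^j]
   suffices; otherwise the summand is dominated by the one for [j = k], which is [1 / A]. *)
Lemma overlap_term_le (s c gamma : R) j : let l := ln n%:R in
  (3 <= j <= k)%N -> (0 < k)%N -> (0 < n)%N -> (2 * k <= n)%N ->
  0 < s -> s <= 1 / 200 -> - ln p <= s * l -> ln 2 <= s * l ->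
  ln k%:R <= s * l -> p <= 1 -> A = expR (gamma * l) -> 0 < l ->
  c <= 3 -> c <= gamma ->
  'C(k, j)%:R * 'C(n, k - j)%:R <=
  expR ((60 * s - c) * l) * ('C(n, k)%:R * p ^+ 'C(j, 2)).
Proof.
move=> l /andP[j3 jk] k0 n0 kn s0 s1 hb h2 hk p1 hA l0 c3 cg.
set b := - ln p in hb; have b0 : 0 <= b by rewrite /b oppr_ge0 ln_le0.
have pE m : p ^+ m = expR (- (b * m%:R)).
  by rewrite -{1}(lnK (x := p)) ?posrE // -expRM_natr /b; congr expR; ring.
have nE m : (n%:R : R) ^+ m = expR (l * m%:R).
  by rewrite -{1}(lnK (x := n%:R)) ?posrE ?ltr0n // -expRM_natr.
have kE m : (k%:R : R) ^+ m = expR (ln k%:R * m%:R).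
  by rewrite -{1}(lnK (x := k%:R)) ?posrE ?ltr0n // -expRM_natr.
have tE m : (2 : R) ^+ m = expR (ln 2 * m%:R).
  by rewrite -{1}(lnK (x := 2)) ?posrE // -expRM_natr.
have J3 : 3 <= j%:R :> R by rewrite ler_nat.
have JK : j%:R <= k%:R :> R by rewrite ler_nat.
have sl0 : 0 < s * l by rewrite mulr_gt0.
have sl1 : s * l <= l / 200 by have := ler_wpM2r (ltW l0) s1; lra.
have cl3 : c * l <= 3 * l by rewrite ler_wpM2r // ltW.
have hn : (n <= 2 * (n - k))%N by exact: leq_double_sub.
have [small|big] := leP ((j%:R - 1) * b) (7 / 4 * l).
  have c1 : 'C(k, j)%:R * 'C(n, k - j)%:R * (n%:R : R) ^+ j <=
      2 ^+ j * k%:R ^+ j * k%:R ^+ j * 'C(n, k)%:R.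
    rewrite -!natrX -!natrM ler_nat.
    apply: (@leq_trans ('C(k, j) * 'C(n, k - j) * (2 * (n - k)) ^ j)).
      by rewrite leq_mul2l leq_exp2r ?(leq_trans _ j3) // hn orbT.
    rewrite expnMn; have := bin_down_le jk (leq_trans (leq_pmull k (ltn0Sn 1)) kn).
    move=> h; have h' := leq_mul (bin_le_expn k j) h.
    apply: leq_trans (_ : 2 ^ j * ('C(k, j) * ('C(n, k - j) * (n - k) ^ j)) <= _)%N.
      by apply: eq_leq; ring.
    by rewrite -!mulnA leq_mul2l h' orbT.
  rewrite nE -ler_pdivlMr ?expR_gt0 // in c1.
  apply: le_trans c1 _; rewrite tE kE pE -expRN.
  set e1 := ln 2 * _; set e2 := ln _ * _; set e3 := - (l * _).
  have -> : expR e1 * expR e2 * expR e2 * 'C(n, k)%:R * expR e3 =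
      expR (e1 + e2 + e2 + e3) * 'C(n, k)%:R by rewrite !expRD; ring.
  set e4 := _ * l; set e5 := - _.
  have -> : expR e4 * ('C(n, k)%:R * expR e5) = expR (e4 + e5) * 'C(n, k)%:R.
    by rewrite !expRD; ring.
  rewrite ler_wpM2r // ler_expR /e1 /e2 /e3 /e4 /e5 natr_bin2.
  have u1 : ln 2 * j%:R + ln k%:R * j%:R + ln k%:R * j%:R <= 3 * (s * l) * j%:R.
    by have : (ln 2 + ln k%:R + ln k%:R) * j%:R <= 3 * (s * l) * j%:R;
      [apply: ler_wpM2r => //; lra|lra].
  (* For [j >= 30], the bound on [(j - 1) b] leaves at least [l / 8 - 3 s l] per common vertex, and
     30 such vertices give more than the required [3 l - 60 s l]. For [j < 30], [b <= s l] and
     [j - 1 <= 29] leave [l - 35/2 s l] per vertex, and three of them suffice: [105/2 <= 60]. *)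
  have [jb|js] := leP 30 (j%:R : R).
    have u2 : (j%:R - 1) * b * j%:R <= 7 / 4 * l * j%:R by apply: ler_wpM2r.
    have u3 : 30 * (l / 8 - 3 * (s * l)) <= j%:R * (l / 8 - 3 * (s * l)).
      by apply: ler_wpM2r => //; lra.
    lra.
  have u2 : (j%:R - 1) * b * j%:R <= 29 * (s * l) * j%:R.
    by apply: ler_wpM2r => //; apply: ler_pM => //; lra.
  have u3 : 3 * (l - 35 / 2 * (s * l)) <= j%:R * (l - 35 / 2 * (s * l)).
    by apply: ler_wpM2r => //; lra.
  lra.
(* Each of the [t] vertices missing from the intersection costs a factor [k n], but gains
   [(k + j - 1) / 2 * b >= 7/4 l] in the exponent. This reduces the bound to [j = k], where
   [A = n^gamma] and [c <= gamma] are used. *)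
set t := (k - j)%N; have tE' : t%:R = k%:R - j%:R :> R by rewrite natrB.
have c1 : 'C(k, j)%:R * 'C(n, t)%:R <= k%:R ^+ t * n%:R ^+ t :> R.
  rewrite -bin_sub // -/t -!natrX; apply: ler_pM => //; rewrite ler_nat; exact: bin_le_expn.
apply: le_trans c1 _; rewrite kE nE -expRD.
have -> : 'C(n, k)%:R = expR (gamma * l + b * N%:R) :> R.
  rewrite expRD -hA /expected_cliques pE -mulrA -expRD addNr expR0 mulr1 //.
rewrite pE -!expRD ler_expR !natr_bin2.
have u1 : c * l <= gamma * l by rewrite ler_wpM2r // ltW.
have u2 : 7 / 4 * l <= (k%:R + j%:R - 1) / 2 * b.
  have : j%:R * b <= k%:R * b by apply: ler_wpM2r.
  lra.
have t0 : 0 <= t%:R :> R by [].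
have u3 : (ln k%:R + l) * t%:R <= (k%:R + j%:R - 1) / 2 * b * t%:R.
  by apply: ler_wpM2r => //; lra.
rewrite tE' in u3 *; lra.
Qed.

End PairOverlaps.

(** * Estimates for fixed n *)

Lemma expRN2_le1B (R : realType) (a : R) : 0 <= a <= 1 / 2 -> expR (- (2 * a)) <= 1 - a.
Proof.
move=> /andP[a0 a2]; rewrite expRN.
apply: (@le_trans _ _ (1 + 2 * a)^-1).
  by rewrite lef_pV2 ?posrE ?expR_gt0 ?expR_ge1Dx //; lra.
rewrite -[leLHS]mul1r ler_pdivrMr; last by lra.
nra.
Qed.

Section FixedSize.
Variables (R : realType) (n k : nat) (p gamma s : R).
Local Notation l := (ln n%:R : R).
Local Notation del := (delta gamma).
Local Notation N := 'C(k, 2).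
Local Notation NR := ('C(k, 2)%:R : R).
Local Notation nR := (n%:R : R).
Local Notation kR := (k%:R : R).
Local Notation x H := ((num_cliques k H)%:R : R).
Hypotheses (l0 : 0 < l) (s0 : 0 < s) (sd : 100 * s <= del).
Hypotheses (p0 : 0 < p) (p1 : p < 1) (ps : - ln p <= s * l).
Hypotheses (k4 : (4 <= k)%N) (ks : ln kR <= s * l) (kn : (2 * k <= n)%N).
Hypotheses (X100 : 100 <= expR (s * l)) (lX : l <= expR (s * l)).
Hypothesis hA : expected_cliques p n k = expR (gamma * l).

(** [X z] is [n^z]. The slack [s] plays the role of [o(1)]: [X s] dominates [k], [1/p], [ln n] and
    every constant up to 100, so each such factor costs one [s] in the exponent. *)
Let X z : R := expR (z * l).
Let A : R := X gamma.

Let XD a b : X a * X b = X (a + b). Proof. by rewrite /X -expRD -mulrDl. Qed.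
Let XV a : (X a)^-1 = X (- a). Proof. by rewrite /X -expRN mulNr. Qed.
Let Xle a b : a <= b -> X a <= X b.
Proof. by move=> ab; rewrite ler_expR ler_wpM2r // ltW. Qed.
Let X0 a : 0 < X a. Proof. exact: expR_gt0. Qed.
Let Xge0 a : 0 <= X a. Proof. exact: expR_ge0. Qed.
Let Xc c a : c <= 100 -> c * X a <= X (a + s).
Proof.
move=> c1; rewrite addrC -XD; apply: ler_wpM2r => //.
by apply: le_trans X100.
Qed.
Let X00 : X 0 = 1. Proof. by rewrite /X mul0r expR0. Qed.
Let A0 : 0 < A. Proof. exact: X0. Qed.

Let n4 : (8 <= n)%N. Proof. by apply: leq_trans kn; rewrite (leq_mul2l 2 4). Qed.
Let nR0 : 0 < nR. Proof. by rewrite ltr0n (leq_trans _ n4). Qed.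
Let kR4 : 4 <= kR. Proof. by rewrite ler_nat. Qed.
Let kR0 : 0 < kR. Proof. by apply: lt_le_trans kR4. Qed.
Let nX : nR = X 1. Proof. by rewrite /X mul1r lnK ?posrE. Qed.
Let n2X : nR ^+ 2 = X 2. Proof. by rewrite nX expr2 XD. Qed.
Let kX : kR <= X s. Proof. by rewrite -[leLHS]lnK ?posrE // ler_expR. Qed.
Let pX : X (- s) <= p.
Proof. by rewrite -[leRHS]lnK ?posrE // ler_expR mulNr lerNl. Qed.
Let N4 : (4 <= N)%N. Proof. by apply: leq_trans (leq_bin2l 2 k4). Qed.
Let NE : NR = kR * (kR - 1) / 2. Proof. exact: natr_bin2. Qed.
Let N0 : 0 < NR. Proof. by rewrite ltr0n (leq_trans _ N4). Qed.
Let NleK : NR <= kR ^+ 2 / 2. Proof. by rewrite NE; move: kR4; nra. Qed.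
Let N2le : NR ^+ 2 <= kR ^+ 4 / 4.
Proof.
have -> : kR ^+ 4 / 4 = (kR ^+ 2 / 2) ^+ 2 by field.
by rewrite ler_sqr ?nnegrE ?(ltW N0) // divr_ge0 ?sqr_ge0.
Qed.
Let k2X : kR ^+ 2 <= X (2 * s).
Proof.
have -> : 2 * s = s + s by ring.
by rewrite -XD expr2 ler_pM // ltW.
Qed.
Let k4X : kR ^+ 4 <= X (4 * s).
Proof.
have -> : 4 * s = 2 * s + 2 * s by ring.
by rewrite -XD (_ : kR ^+ 4 = kR ^+ 2 * kR ^+ 2) ?ler_pM ?sqr_ge0 //; ring.
Qed.
Let del10 : 10 * del <= 1.
Proof. by rewrite /delta mulrC divfK // ge_min lexx orbT. Qed.
Let delg : 10 * del <= gamma - 2.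
Proof. by rewrite /delta mulrC divfK // ge_min lexx. Qed.
Let s1 : s <= 1 / 200. Proof. by move: sd del10; lra. Qed.
Let n100 : 100 <= nR.
Proof. by apply: le_trans X100 _; rewrite [leRHS]nX; apply: Xle; move: s1; lra. Qed.
Let pn0 : 0 < p * nR ^+ 2. Proof. by rewrite mulr_gt0 // exprn_gt0. Qed.

(** By the choice of [delta], [2 + 10 delta] is the minimum of [gamma] and 3. Pairs of cliques with
    three common vertices account for [n^(-3)], and identical ones for [n^(-gamma)]. *)
Let tau : R := X (60 * s - (2 + 10 * del)).
Let theta : R := kR * NR ^+ 2 * tau.

Let theta_le : theta <= X (65 * s - 2 - 10 * del).
Proof.
rewrite /theta /tau.
have -> : X (65 * s - 2 - 10 * del) = X s * X (4 * s) * X (60 * s - (2 + 10 * del)).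
  by rewrite !XD; congr X; ring.
apply: ler_wpM2r => //; apply: ler_pM => //.
have : kR ^+ 4 / 4 <= kR ^+ 4 by have := exprn_ge0 4 (ltW kR0); lra.
by move: k4X N2le; lra.
Qed.

Let overlaps_theta : pair_overlaps n k p <= theta * expected_cliques p n k ^+ 2.
Proof.
apply: (pair_overlaps_le p0 (Xge0 _)) => j jk.
have q1 : (0 < k)%N by rewrite (leq_trans _ k4).
have q2 : (0 < n)%N by rewrite (leq_trans _ n4).
have q3 : ln 2 <= s * l.
  rewrite -[leRHS]expRK ler_ln ?posrE ?expR_gt0 //.
  by apply: le_trans X100; lra.
have q4 : 2 + 10 * del <= 3 by move: del10; lra.
have q5 : 2 + 10 * del <= gamma by move: delg; lra.
exact: (@overlap_term_le _ n k p p0 s _ gamma j jk q1 q2 kn s0 s1 ps q3 ks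
  (ltW p1) hA l0 q4 q5).
Qed.

(** * Typical initial graphs *)

Let C2 : R := 'C(n, 2)%:R.
Let C2E : C2 = nR * (nR - 1) / 2. Proof. exact: natr_bin2. Qed.
Let C2ge : 19 / 40 * nR ^+ 2 <= C2. Proof. by rewrite C2E; move: n100; nra. Qed.
Let C2le : C2 <= nR ^+ 2 / 2. Proof. by rewrite C2E; move: n100; nra. Qed.
Let p01 : 0 <= p <= 1. Proof. by rewrite !ltW. Qed.

(** The last three thresholds exceed the bounds on the expectations by a factor of at least [n^s],
    so Markov's inequality leaves [n^(-s)] for each. *)
Definition typical (H : graph n) : bool :=
  [&& 9 / 20 * (p * nR ^+ 2) <= #|H|%:R,
      (x H - A) ^+ 2 <= X (- 2 + 10 * s) * A ^+ 2,
      clique_var R k H <= X (- 2 - 10 * del + 66 * s) * A ^+ 2 &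
      clique_overlaps R k H <= X (- 2 - 10 * del + 66 * s) * A ^+ 2].

Let fail_edges :
  \sum_(H : graph n | ~~ (9 / 20 * (p * nR ^+ 2) <= #|H|%:R)) gnp_mass p H <= X (- s).
Proof.
(* The mean is at least [19/40 p n^2], and [19/40 - 9/20 = 1/40]. *)
pose t : R := p * nR ^+ 2 / 40.
have t0 : 0 < t by rewrite divr_gt0.
apply: le_trans (gnp_markov (t := t ^+ 2) p01
  (fun H => sqr_ge0 (#|H|%:R - C2 * p)) (gnp_card_var n p01) _ _) _.
- by rewrite exprn_gt0.
- move=> H; rewrite -ltNge => h.
  have h1 : t <= C2 * p - #|H|%:R.
    by have := ler_wpM2r (ltW p0) C2ge; rewrite /t; lra.
  by rewrite -(sqrrN (_ - _)) opprB ler_sqr ?nnegrE ?(ltW t0) // (le_trans (ltW t0)).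
rewrite -/C2 ler_pdivrMr ?exprn_gt0 //.
have h1 : 20 <= X (- s) * t.
  have c40 : 40 * 20 <= X s * X s by apply: ler_pM => //; rewrite /X; move: X100; lra.
  have : X s * X s <= X (- s) * (X (- s) * X 2).
    by rewrite !XD; apply: Xle; move: s1; lra.
  have : X (- s) * (X (- s) * X 2) <= X (- s) * (p * nR ^+ 2).
    by rewrite n2X ler_wpM2l // ler_wpM2r.
  rewrite /t; lra.
have h2 := ler_wpM2r (ltW t0) h1.
have h3 := ler_wpM2r (ltW p0) C2le.
apply: (@le_trans _ _ (20 * t)); first by rewrite /t; lra.
by rewrite expr2 [leRHS]mulrA.
Qed.

Let fail_count :
  \sum_(H : graph n | ~~ ((x H - A) ^+ 2 <= X (- 2 + 10 * s) * A ^+ 2)) gnp_mass p H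
  <= X (- s).
Proof.
have n2 : (2 <= n)%N by rewrite (leq_trans _ n4).
have k2 : (2 <= k)%N by rewrite (leq_trans _ k4).
have := gnp_cliques_var n2 k2 p0 overlaps_theta; rewrite hA -/(X gamma) -/A => h.
apply: le_trans (gnp_markov p01 (fun H => sqr_ge0 (x H - A)) h _
   (t := X (- 2 + 10 * s) * A ^+ 2) _) _.
- by rewrite mulr_gt0 // exprn_gt0.
- by move=> H; rewrite -ltNge => /ltW.
rewrite ler_pdivrMr ?mulr_gt0 ?exprn_gt0 // [leRHS]mulrA ler_wpM2r ?sqr_ge0 //.
have b1 : NR ^+ 2 / ('C(n, 2)%:R * p) <= X (5 * s - 2).
  rewrite ler_pdivrMr ?mulr_gt0 ?ltr0n ?bin_gt0 // -/C2.
  apply: le_trans (_ : X (4 * s) / 4 <= _).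
    by apply: le_trans N2le _; rewrite ler_wpM2r.
  apply: le_trans (_ : X (5 * s - 2) * (19 / 40 * X 2 * X (- s)) <= _); last first.
    rewrite ler_wpM2l //; apply: ler_pM.
    - by apply: mulr_ge0.
    - exact: Xge0.
    - by rewrite -n2X.
    - exact: pX.
  have -> : X (5 * s - 2) * (19 / 40 * X 2 * X (- s)) = 19 / 40 * X (4 * s).
    rewrite (_ : 4 * s = 5 * s - 2 + 2 + - s) -?XD; ring.
  by have := Xge0 (4 * s); lra.
have b2 : theta <= X (5 * s - 2).
  by apply: le_trans theta_le _; apply: Xle; move: sd s0; lra.
rewrite XD; apply: le_trans (_ : 2 * X (5 * s - 2) <= _); first by lra.
by apply: le_trans (Xc _ _) _; [lra|apply: Xle; move: s0; lra].
Qed.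

Let fail_var :
  \sum_(H : graph n | ~~ (clique_var R k H <= X (- 2 - 10 * del + 66 * s) * A ^+ 2))
     gnp_mass p H <= X (- s).
Proof.
have n2 : (2 <= n)%N by rewrite (leq_trans _ n4).
have k2 : (2 <= k)%N by rewrite (leq_trans _ k4).
have := gnp_clique_var n2 k2 p0 (ltW p1) overlaps_theta; rewrite hA -/(X gamma) -/A => h.
apply: le_trans (gnp_markov p01 (clique_var_ge0 R k (n := n)) h _
   (t := X (- 2 - 10 * del + 66 * s) * A ^+ 2) _) _.
- by rewrite mulr_gt0 // exprn_gt0.
- by move=> H; rewrite -ltNge => /ltW.
rewrite ler_pdivrMr ?mulr_gt0 ?exprn_gt0 // [leRHS]mulrA ler_wpM2r ?sqr_ge0 //.
by apply: le_trans theta_le _; rewrite XD; apply: Xle; lra.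
Qed.

Let fail_overlaps :
  \sum_(H : graph n | ~~ (clique_overlaps R k H <= X (- 2 - 10 * del + 66 * s) * A ^+ 2))
     gnp_mass p H <= X (- s).
Proof.
have h := overlaps_theta; rewrite -gnp_mean_overlaps hA -/(X gamma) -/A in h.
apply: le_trans (gnp_markov p01 (clique_overlaps_ge0 R k (n := n)) h _
   (t := X (- 2 - 10 * del + 66 * s) * A ^+ 2) _) _.
- by rewrite mulr_gt0 // exprn_gt0.
- by move=> H; rewrite -ltNge => /ltW.
rewrite ler_pdivrMr ?mulr_gt0 ?exprn_gt0 // [leRHS]mulrA ler_wpM2r ?sqr_ge0 //.
by apply: le_trans theta_le _; rewrite XD; apply: Xle; lra.
Qed.

Lemma atypical_prob_le : \sum_(H | ~~ typical H) gnp_mass p H <= 4 * X (- s).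
Proof.
have neg (a b : pred (graph n)) : \sum_(H | ~~ (a H && b H)) gnp_mass p H <=
    \sum_(H | ~~ a H) gnp_mass p H + \sum_(H | ~~ b H) gnp_mass p H.
  rewrite big_mkcond [X in _ <= X + _]big_mkcond [X in _ <= _ + X]big_mkcond /=.
  rewrite -big_split; apply: ler_sum => H _ /=; have m0 := gnp_mass_ge0 H p01.
  by case: (a H); case: (b H) => /=; lra.
have f1 := fail_edges; have f2 := fail_count; have f3 := fail_var.
have f4 := fail_overlaps.
apply: le_trans (neg _ _) _; apply: le_trans (lerD f1 (neg _ _)) _.
apply: le_trans (lerD (lexx _) (lerD f2 (neg _ _))) _.
apply: le_trans (lerD (lexx _) (lerD (lexx _) (lerD f3 f4))) _; lra.
Qed.


(** * Constants of the tracking argument *)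

Let powRX z : nR `^ z = X z. Proof. by rewrite /powR gt_eqF. Qed.

Definition steps : nat := Num.truncn (m_star n k p gamma).

Let del0 : 0 < del. Proof. by move: sd s0; lra. Qed.

Let m_star_ge0 : 0 <= m_star n k p gamma.
Proof.
have d0 := ltW del0; have pp := ltW p0; have ll := ltW l0.
rewrite /m_star le_min ler0z floor_ge0; apply/andP; split.
  apply: divr_ge0; last by rewrite mulr_ge0 // exprn_ge0 // ltW.
  by rewrite mulr_ge0 // mulr_ge0 ?sqr_ge0 // mulr_ge0.
apply: divr_ge0; last by rewrite mulr_ge0 // sqr_ge0.
by rewrite mulr_ge0 // sqr_ge0.
Qed.

Lemma le_steps m : m%:R < m_star n k p gamma -> (m <= steps)%N.
Proof. by move=> h; rewrite /steps truncn_ge_nat ?m_star_ge0 // ltW. Qed.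

Let steps_le : steps%:R <= m_star n k p gamma.
Proof. by rewrite /steps truncn_le m_star_ge0. Qed.

Let steps_le1 : steps%:R <= del * p * nR ^+ 2 * l / (4 * kR ^+ 4).
Proof.
apply: le_trans steps_le _; rewrite /m_star ge_min; apply/orP; left.
exact: floor_le.
Qed.

Let steps_le2 : steps%:R <= p * nR ^+ 2 / (2 * kR ^+ 2).
Proof. by apply: le_trans steps_le _; rewrite /m_star ge_min lexx orbT. Qed.

(** At least [p n^2 / 5] edges remain throughout: [9/20 p n^2] are present initially, and at most
    [p n^2 / 4] are removed. *)
Let abar : R := 5 * NR ^+ 2 / (p * nR ^+ 2).

Let abar_ge0 : 0 <= abar.
Proof. by rewrite divr_ge0 ?mulr_ge0 ?sqr_ge0 // ltW. Qed.

Let abarX : abar <= X (6 * s - 2).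
Proof.
rewrite ler_pdivrMr //.
apply: (@le_trans _ _ (X (6 * s - 2) * (X (- s) * X 2))); last first.
  by rewrite ler_wpM2l // n2X ler_wpM2r.
have -> : X (6 * s - 2) * (X (- s) * X 2) = X (4 * s + s) by rewrite !XD; congr X; ring.
apply: le_trans (Xc (c := 2) _ _); last by lra.
by move: k4X N2le (Xge0 (4 * s)); lra.
Qed.

(** [N^2 <= k^4 / 4] and the first bound in [m_star] give [5 * 1/4 * 1/4]. The other multiples of
    [delta] derive from this one: [5/8 = 2 * 5/16] in [rho], through [1 - a >= exp(- 2 a)], and
    [45/8 = 18 * 5/16] in [growth_le]. *)
Let abar_steps : abar * steps%:R <= 5 / 16 * del * l.
Proof.
have h1 : abar <= 5 * (kR ^+ 4 / 4) / (p * nR ^+ 2).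
  by rewrite ler_wpM2r ?invr_ge0 ?(ltW pn0) // ler_wpM2l.
apply: le_trans (ler_pM _ _ h1 steps_le1) _ => //.
rewrite le_eqVlt; apply/orP; left; apply/eqP; field.
by rewrite !gt_eqF.
Qed.

Let abar2 : abar <= 1 / 2.
Proof.
apply: le_trans abarX _; apply: (@le_trans _ _ (X (- s))).
  by apply: Xle; move: s1; lra.
have := @Xc 2 (- s); rewrite addNr X00 => h.
have : 2 * X (- s) <= 1 by apply: h; lra.
lra.
Qed.

Let steps_X2 : steps%:R <= X 2.
Proof.
apply: le_trans steps_le2 _; rewrite -n2X ler_pdivrMr ?mulr_gt0 ?exprn_gt0 //.
rewrite mulrC ler_wpM2l ?sqr_ge0 //.
have : 4 * 4 <= kR * kR by apply: ler_pM.
by move: p1; rewrite expr2; lra.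
Qed.

Let rho : R := X (- (5 / 8 * del)).
Let Dm : R := X (- 2 - 10 * del + 66 * s) * A ^+ 2.
Let Mq : R := X (- 1 + 4 * s) * A.
(** This is the half-width at time 0, in units of the scaled count; the product in [g_Q] only widens
    the tube later. *)
Let lam : R := 2 * X (- del) * A.

Let N_X : NR <= X (2 * s).
Proof. by move: k2X NleK (Xge0 (2 * s)); lra. Qed.

Let Mq_le : 2 * (NR * Mq) <= A * rho.
Proof.
rewrite /Mq /rho [leRHS]mulrC.
have -> : 2 * (NR * (X (- 1 + 4 * s) * A)) = 2 * (NR * X (- 1 + 4 * s)) * A by ring.
apply: ler_wpM2r; first exact: ltW.
apply: (@le_trans _ _ (2 * X (2 * s + (- 1 + 4 * s)))).
  by rewrite ler_wpM2l // -XD ler_wpM2r.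
by apply: le_trans (Xc _ _) _; [lra|apply: Xle; move: s1 del10; lra].
Qed.

Let growth_le : (1 + 18 * abar) ^+ steps <= X (45 / 8 * del).
Proof.
apply: (@le_trans _ _ (expR (18 * abar) ^+ steps)).
  by apply: lerXn2r; rewrite ?nnegrE ?expR_ge0 ?expR_ge1Dx // addr_ge0 // mulr_ge0.
rewrite -expRM_natr ler_expR; move: abar_steps; lra.
Qed.

(** [55/8] is [45/8] from [growth_le] plus [5/4] from [rho ^+ 2]. This and the next inequality spend
    at most [69 s], hence less than the spare [9/8 delta]. *)
Let exp3 : 55 / 8 * del + (- 10 * del + 66 * s) + s <= - s + - (2 * del).
Proof. by move: sd s0; lra. Qed.
Let exp4 : 55 / 8 * del + s + (- 10 * del + 66 * s) + s <= - s + - (2 * del).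
Proof. by move: sd s0; lra. Qed.

Let abar_steps_X : abar * steps%:R <= X s.
Proof.
apply: le_trans abar_steps _; apply: le_trans lX.
have : del * l <= 1 * l by apply: ler_wpM2r; [exact: ltW|move: del10; lra].
by move: l0; lra.
Qed.

(** * The process started from a typical graph *)

Section Typical.
Variable H : graph n.
Hypothesis tH : typical H.

Let rate i : R := NR ^+ 2 / (#|H|%:R - i%:R * NR).
Let g := g_Q n k gamma #|H|.

Let edges_ge i : (i <= steps)%N -> p * nR ^+ 2 / 5 <= #|H|%:R - i%:R * NR.
Proof.
move=> iM; have /and4P[h _ _ _] := tH.
have : i%:R * NR <= p * nR ^+ 2 / (2 * kR ^+ 2) * (kR ^+ 2 / 2).
  apply: ler_pM => //; apply: le_trans steps_le2; by rewrite ler_nat.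
have -> : p * nR ^+ 2 / (2 * kR ^+ 2) * (kR ^+ 2 / 2) = p * nR ^+ 2 / 4.
  by field; rewrite gt_eqF.
by lra.
Qed.

Let edges_gt0 i : (i <= steps)%N -> 0 < #|H|%:R - i%:R * NR.
Proof. by move=> iM; apply: lt_le_trans (edges_ge iM); rewrite divr_gt0. Qed.

Let rate_le i : (i <= steps)%N -> rate i <= abar.
Proof.
move=> iM; have h := edges_ge iM; have h0 := edges_gt0 iM.
rewrite /rate ler_pdivrMr // /abar.
have : 1 <= 5 / (p * nR ^+ 2) * (#|H|%:R - i%:R * NR).
  by rewrite mulrAC ler_pdivlMr // mul1r; lra.
by move=> /(ler_wpM2l (sqr_ge0 NR)); lra.
Qed.

Let rate_ge0 i : (i <= steps)%N -> 0 <= rate i.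
Proof. by move=> iM; rewrite divr_ge0 ?sqr_ge0 // ltW // edges_gt0. Qed.

Let decay_ge m : (m <= steps)%N -> rho <= \prod_(0 <= i < m) (1 - rate i).
Proof.
move=> mM; apply: (@le_trans _ _ (expR (- (2 * abar)) ^+ m)).
  rewrite /rho /X -expRM_natr ler_expR.
  have : abar * m%:R <= abar * steps%:R by rewrite ler_wpM2l // ler_nat.
  by move: abar_steps; lra.
rewrite -[m in X in X <= _]subn0 -prodr_const_nat; rewrite big_nat [leRHS]big_nat.
apply: ler_prod => i /andP[_ im]; rewrite expR_ge0 /=.
apply: le_trans (expRN2_le1B _) _; first by rewrite abar_ge0 abar2.
by have := rate_le (ltnW (leq_trans im mM)); lra.
Qed.

Let growth1 m : (m <= steps)%N -> 1 <= \prod_(0 <= i < m) (1 + rate i) <= X (5 / 16 * del).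
Proof.
move=> mM; apply/andP; split.
  rewrite big_nat; apply: (big_ind (fun z => 1 <= z)) => //.
    by move=> u v u1 v1; rewrite -[1]mulr1; apply: ler_pM.
  by move=> i /andP[_ im]; have := rate_ge0 (ltnW (leq_trans im mM)); lra.
apply: (@le_trans _ _ (expR abar ^+ m)).
  rewrite -[m in X in _ <= X]subn0 -prodr_const_nat; rewrite big_nat [leRHS]big_nat.
  apply: ler_prod => i /andP[_ im]; have iM := ltnW (leq_trans im mM).
  have := rate_ge0 iM; have := rate_le iM; have := expR_ge1Dx abar; lra.
rewrite -expRM_natr ler_expR.
have : abar * m%:R <= abar * steps%:R by rewrite ler_wpM2l // ler_nat.
by move: abar_steps; lra.
Qed.

Let g_le m : (m <= steps)%N -> g m <= 1 / 2.
Proof.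
move=> mM; have /andP[_ h] := growth1 mM.
rewrite /g /g_Q powRX.
apply: le_trans (ler_wpM2l _ h) _; first by rewrite mulr_ge0.
have -> : 2 * X (- del) * X (5 / 16 * del) = 4 * X (- del + 5 / 16 * del) / 2.
  by rewrite -XD; field.
rewrite ler_wpM2r //; apply: le_trans (Xc _ _) _; first by lra.
by rewrite -[leRHS]X00; apply: Xle; move: sd s0; lra.
Qed.

Let lam_le m : (m <= steps)%N -> lam <= g m * A.
Proof.
move=> mM; have /andP[h _] := growth1 mM.
rewrite /lam /g /g_Q powRX ler_wpM2r // ?(ltW A0) //.
by rewrite ler_peMr // mulr_ge0.
Qed.

Let count_le : x H <= 2 * A.
Proof.
have /and4P[_ h _ _] := tH.
have h1 : (x H - A) ^+ 2 <= A ^+ 2.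
  apply: le_trans h _; rewrite ler_piMl ?sqr_ge0 // -[leRHS]X00; apply: Xle.
  by move: s1; lra.
rewrite leNgt; apply/negP => h2.
have h3 : A * A < (x H - A) * (x H - A) by apply: ltr_pM; rewrite ?ltW //; lra.
by move: h1; rewrite !expr2; lra.
Qed.

(** A single squared degree is at most the sum of all of them, [V + N^2 Q^2 / e(G)], and both terms
    are of order [n^(-2 + o(1)) A^2]. *)
Let degree_le e : clique_degree R k H e <= Mq.
Proof.
have Mq0 : 0 <= Mq by rewrite mulr_ge0 // ltW.
have [eH|eH] := boolP (e \in H); last first.
  rewrite /clique_degree /degree big1 // => K Kc; rewrite /incidence.
  by have /fintype.subsetP sK := cliques_edges_sub Kc; rewrite (contraNF (sK e) eH).
rewrite -(@ler_sqr _ _ Mq) ?nnegrE //; last exact: degree_ge0.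
apply: (@le_trans _ _ (\sum_(f in H) clique_degree R k H f ^+ 2)).
  rewrite (bigD1 e) //= lerDl; apply: sumr_ge0 => f _; exact: sqr_ge0.
rewrite clique_degree_sqr_sum; last by rewrite (leq_trans _ N4).
have /and4P[_ _ hV _] := tH.
have hr := rate_le (leq0n _); rewrite /rate mul0r subr0 in hr.
have x2 : x H ^+ 2 <= (2 * A) ^+ 2.
  by rewrite ler_sqr ?nnegrE ?mulr_ge0 ?(ltW A0).
have h1 : NR ^+ 2 / #|H|%:R * x H ^+ 2 <= X (6 * s - 2) * (2 * A) ^+ 2.
  by apply: ler_pM; [rewrite divr_ge0 ?sqr_ge0|exact: sqr_ge0
    |exact: le_trans abarX|exact: x2].
apply: le_trans (lerD hV h1) _.
have h2 : X (- 2 - 10 * del + 66 * s) <= X (6 * s - 2).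
  by apply: Xle; move: sd s0; lra.
have h3 := ler_wpM2r (sqr_ge0 A) h2.
apply: (@le_trans _ _ (5 * X (6 * s - 2) * A ^+ 2)); first by lra.
have -> : Mq ^+ 2 = X (- 2 + 8 * s) * A ^+ 2.
  by rewrite /Mq exprMn expr2 XD; congr (X _ * _); ring.
apply: ler_wpM2r; first exact: sqr_ge0.
by apply: le_trans (Xc _ _) _; [lra|apply: Xle; move: s0; lra].
Qed.

Let typical_inv : tracking_inv k #|H| Mq Dm 0 H.
Proof.
have /and4P[_ _ _ hD] := tH.
by split; [rewrite mul0r subr0|exact: hD|exact: degree_le].
Qed.

(** The initial squared error, the constant drift, the initial variance and the inflow of overlaps
    into the variance are each at most [n^(-s - 2 delta) A^2], while [lam ^+ 2] is
    [4 n^(-2 delta) A^2]. *)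
Let potential_le :
  tracking_potential k #|H| steps A abar Mq Dm rho lam 0 H <= 4 * X (- s).
Proof.
have /and4P[_ hx hV _] := tH.
rewrite /tracking_potential big_nil divr1 subr0 expr0 divr1.
rewrite ler_pdivrMr ?exprn_gt0 ?mulr_gt0 //.
set M : R := steps%:R; have M0 : 0 <= M by [].
have A2 := sqr_ge0 A.
have lamE : lam ^+ 2 = 4 * X (- (2 * del)) * A ^+ 2.
  have -> : - (2 * del) = - del + - del by ring.
  by rewrite -XD /lam; ring.
have irho : (rho ^+ 2)^-1 = X (5 / 4 * del).
  by rewrite /rho expr2 XD XV; congr X; field.
have MD : M * Dm <= X (- 10 * del + 66 * s) * A ^+ 2.
  rewrite /Dm mulrA; apply: ler_wpM2r => //.
  have -> : X (- 10 * del + 66 * s) = X 2 * X (- 2 - 10 * del + 66 * s).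
    by rewrite XD; congr X; ring.
  by apply: ler_wpM2r.
have MV : M * clique_var R k H <= X (- 10 * del + 66 * s) * A ^+ 2.
  by apply: le_trans MD; apply: ler_wpM2l.
have D0 : 0 <= Dm by rewrite mulr_ge0.
have Mq0 : 0 <= Mq by rewrite mulr_ge0 // ltW.
have Mk : M * (2 * Dm + 4 * abar ^+ 2 * A ^+ 2 + 2 * abar * (NR * Mq) * A) <=
    X (- 10 * del + 67 * s) * A ^+ 2.
  have t1 : M * abar ^+ 2 <= X (- 10 * del + 66 * s).
    apply: (@le_trans _ _ (X 2 * X (6 * s - 2) ^+ 2)).
      apply: ler_pM; rewrite ?sqr_ge0 //.
      by rewrite ler_sqr ?nnegrE.
    by rewrite expr2 !XD; apply: Xle; move: del10 s1 s0; lra.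
  have t2 : M * abar * NR * X (- 1 + 4 * s) <= X (- 10 * del + 66 * s).
    apply: (@le_trans _ _ (X 2 * X (6 * s - 2) * X (2 * s) * X (- 1 + 4 * s))).
      apply: ler_wpM2r => //; apply: ler_pM.
      - by rewrite mulr_ge0.
      - exact: ler0n.
      - by apply: ler_pM.
      - exact: N_X.
    by rewrite !XD; apply: Xle; move: del10 s1 s0; lra.
  have u1 := ler_wpM2r A2 t1; have u2 := ler_wpM2r A2 t2.
  apply: (@le_trans _ _ (8 * X (- 10 * del + 66 * s) * A ^+ 2)).
    by move: MD; rewrite /Mq; lra.
  apply: ler_wpM2r => //; apply: le_trans (Xc _ _) _; first by lra.
  by apply: Xle; lra.
have b1 : (x H - A) ^+ 2 <= X (- s) * (X (- (2 * del)) * A ^+ 2).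
  apply: le_trans hx _; rewrite mulrA; apply: ler_wpM2r => //.
  by rewrite XD; apply: Xle; move: del10 s1 s0; lra.
have b2 : M * ((2 * Dm + 4 * abar ^+ 2 * A ^+ 2 + 2 * abar * (NR * Mq) * A) / rho ^+ 2)
    <= X (- s) * (X (- (2 * del)) * A ^+ 2).
  rewrite mulrA irho; apply: le_trans (ler_wpM2r (Xge0 _) Mk) _.
  rewrite mulrAC mulrA; apply: ler_wpM2r => //.
  by rewrite !XD; apply: Xle; move: sd s0; lra.
have rM : 3 / rho ^+ 2 * (1 + 18 * abar) ^+ steps <= 3 * X (55 / 8 * del).
  rewrite irho -mulrA; apply: ler_wpM2l => //.
  have -> : X (55 / 8 * del) = X (5 / 4 * del) * X (45 / 8 * del).
    by rewrite XD; congr X; field.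
  by apply: ler_wpM2l.
have rM0 : 0 <= 3 / rho ^+ 2 * (1 + 18 * abar) ^+ steps.
  by rewrite irho mulr_ge0 ?mulr_ge0 // exprn_ge0 // addr_ge0 // mulr_ge0.
have b3 : M * (3 / rho ^+ 2 * (1 + 18 * abar) ^+ steps * clique_var R k H) <=
    X (- s) * (X (- (2 * del)) * A ^+ 2).
  rewrite mulrCA; apply: (@le_trans _ _ (3 * X (55 / 8 * del) *
     (X (- 10 * del + 66 * s) * A ^+ 2))).
    by apply: ler_pM => //; rewrite mulr_ge0 // clique_var_ge0.
  have swap (u v w : R) : 3 * u * (v * w) = 3 * (u * v) * w by ring.
  rewrite swap.
  rewrite [leRHS]mulrA; apply: ler_wpM2r => //.
  rewrite !XD; apply: (@le_trans _ _ (X (55 / 8 * del + (- 10 * del + 66 * s) + s))).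
    by apply: Xc; rewrite ler_nat.
  exact: Xle exp3.
have aM : abar * M <= X s := abar_steps_X.
have b4 : M * (3 / rho ^+ 2 * (1 + 18 * abar) ^+ steps * (11 * abar * Dm * M)) <=
    X (- s) * (X (- (2 * del)) * A ^+ 2).
  have swap (u v w : R) : M * (u * (11 * v * w * M)) = u * (11 * (v * M) * (M * w)).
    by ring.
  rewrite swap.
  apply: (@le_trans _ _ (3 * X (55 / 8 * del) *
     (11 * X s * (X (- 10 * del + 66 * s) * A ^+ 2)))).
    have aM0 : 0 <= 11 * (abar * M) by apply: mulr_ge0 => //; exact: mulr_ge0.
    have MD0 : 0 <= M * Dm by exact: mulr_ge0.
    apply: ler_pM; [exact: rM0|exact: mulr_ge0|exact: rM|].
    by apply: ler_pM => //; apply: ler_wpM2l.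
  have swap2 (u v w z : R) : 3 * u * (11 * v * (w * z)) = 33 * (u * v * w) * z by ring.
  rewrite swap2.
  rewrite [leRHS]mulrA; apply: ler_wpM2r => //.
  rewrite !XD.
  apply: (@le_trans _ _ (X (55 / 8 * del + s + (- 10 * del + 66 * s) + s))).
    by apply: Xc; rewrite ler_nat.
  exact: Xle exp4.
rewrite lamE -/M.
have f0 : 0 <= X (- s) * (X (- (2 * del)) * A ^+ 2).
  by apply: mulr_ge0 => //; exact: mulr_ge0.
have split4 (a b c v w : R) : a + M * (b + c * (v + w)) =
  a + M * b + M * (c * v) + M * (c * w) by ring.
rewrite split4; apply: le_trans (lerD (lerD (lerD b1 b2) b3) b4) _.
set F := X (- s) * _ in f0 *.
have swap (u v w : R) : 4 * u * (4 * v * w) = 16 * (u * (v * w)) by ring.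
rewrite swap -/F.
have sum4 (u : R) : u + u + u + u = 4 * u by ring.
rewrite sum4.
by apply: ler_wpM2r => //; rewrite ler_nat.
Qed.

Lemma typical_fails_le (d : measure_display) (T : measurableType d)
    (P : probability T R) (G : nat -> T -> option (graph n)) :
  clique_removal_process k p P G ->
  (P ([set w | G 0%N w = Some H] `&`
      fails G (count_good k #|H| A (g_Q n k gamma #|H|)) 0 steps)%classic <=
   (gnp_mass p H * (4 * X (- s)))%:E)%E.
Proof.
move=> hG; apply: (@le_trans _ _ (gnp_mass p H *
    tracking_potential k #|H| steps A abar Mq Dm rho lam 0 H)%:E).
  apply: (initial_tracking_fails_le hG N4 (X0 _) decay_ge _ _ abar_ge0 abar2
    A0 Mq_le _ _ g_le _ lam_le typical_inv).
  - by move=> i iM; apply: edges_gt0; exact: ltnW.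
  - by move=> i iM; apply: rate_le; exact: ltnW.
  - by rewrite mulr_ge0 // ltW.
  - by rewrite mulr_ge0 ?sqr_ge0.
  - by rewrite !mulr_gt0.
by rewrite lee_fin; apply: ler_wpM2l; [exact: gnp_mass_ge0|exact: potential_le].
Qed.

End Typical.
End FixedSize.

(** * The limit *)

Local Open Scope classical_set_scope.
Local Open Scope ring_scope.

Lemma measurable_tracked (R : realType) (n k : nat) (p gamma : R)
    (d : measure_display) (T : measurableType d) (P : probability T R)
    (G : nat -> T -> option (graph n)) :
  clique_removal_process k p P G -> measurable (clique_count_tracked k p gamma G).
Proof.
move=> hG; rewrite /clique_count_tracked.
pose B (H : graph n) m : set (option (graph n)) := [set s | exists2 Gm, s = Some Gm &
      ((num_cliques k Gm)%:R : R) \in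
        `[Q_tilde n k gamma #|H| m * (1 - g_Q n k gamma #|H| m),
           Q_tilde n k gamma #|H| m * (1 + g_Q n k gamma #|H| m)]].
rewrite (_ : mkset _ = \bigcup_(H in [set: graph n]) ([set w | G 0%N w = Some H] `&`
   \bigcap_(m in [set m | m%:R < m_star n k p gamma]) [set w | B H m (G m w)])).
  apply: fin_bigcup_measurable; first exact: finite_finset.
  move=> H _; apply: measurableI; first exact: process_measurable hG _ _.
  by apply: bigcap_measurableType => m _; exact: (measurable_state hG).
apply/seteqP; split => w.
  by move=> [H GH h]; exists H => //; split => // m mm; exact: h.
by move=> [H _ [GH h]]; exists H => // m mm; exact: h.
Qed.

Lemma tracked_prob_ge_fixed (R : realType) (n k : nat) (p gamma s : R)
    (d : measure_display) (T : measurableType d) (P : probability T R)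
    (G : nat -> T -> option (graph n)) :
  let l : R := ln n%:R in
  0 < l -> 0 < s -> 100 * s <= delta gamma -> 0 < p -> p < 1 -> - ln p <= s * l ->
  (4 <= k)%N -> ln k%:R <= s * l -> (2 * k <= n)%N ->
  100 <= expR (s * l) -> l <= expR (s * l) ->
  expected_cliques p n k = expR (gamma * l) ->
  clique_removal_process k p P G ->
  ((1 - 8 * expR (- s * l))%:E <= P (clique_count_tracked k p gamma G))%E.
Proof.
move=> l l0 s0 sd p0 p1 ps k4 ks kn X100 lX hA hG.
have p01 : 0 <= p <= 1 by rewrite !ltW.
have at_le := atypical_prob_le l0 s0 sd p0 p1 ps k4 ks kn X100 hA.
have e0 : 0 <= 4 * expR (- s * l) by rewrite mulr_ge0 ?expR_ge0.
have tp := tracked_prob_ge hG p01 e0 (fun H tH =>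
  typical_fails_le l0 s0 sd p0 p1 ps k4 ks kn X100 lX tH hG)
  (measurable_tracked gamma hG).
apply: le_trans (tp _); first by rewrite lee_fin; lra.
move=> w H GH good; exists H => // m mm.
have mS := le_steps l0 s0 sd p0 mm.
have := good m mS; case: (G m w) => //= Gm.
rewrite /count_good => gm; exists Gm => //; rewrite /Q_tilde.
have nn : (n%:R : R) `^ gamma = expR (gamma * l).
  rewrite /powR gt_eqF // ltr0n; apply: leq_trans kn.
  by rewrite muln_gt0 (leq_trans _ k4).
by rewrite nn.
Qed.

Lemma near_ln_ge (R : realType) (L : R) : \forall n \near \oo, L <= ln (n%:R : R).
Proof.
near=> n.
have h : expR L < n%:R by near: n; exact: nbhs_infty_gtr.
rewrite -[leLHS]expRK ler_ln ?posrE ?expR_gt0 //; first exact: ltW.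
exact: lt_trans (expR_gt0 L) h.
Unshelve. all: by end_near.
Qed.

Lemma expR_ge_sqr (R : realType) (y : R) : 0 <= y -> 1 + y ^+ 2 / 2 <= expR y.
Proof. by move=> y0; have := expR_ge1Dxn 1 y0. Qed.

(** Since [C(n, k) <= n^k], an expectation of at least 1 forces [(k - 1) ln (1/p) <= 2 ln n]. As [p]
    stays away from 1, [k] is at most logarithmic in [n]. *)
Lemma clique_size_le (R : realType) (n k : nat) (p b0 : R) :
  (0 < n)%N -> (0 < k)%N -> 0 < p -> 0 < b0 -> b0 <= - ln p ->
  1 <= expected_cliques p n k -> k%:R <= 1 + 2 * ln n%:R / b0.
Proof.
move=> n0 k0 p0 b00 bp hE.
have nn : 0 < n%:R :> R by rewrite ltr0n.
have h : 0 <= ln n%:R * k%:R + ln p * 'C(k, 2)%:R.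
  rewrite -ler_expR expR0 expRD !expRM_natr !lnK ?posrE //; apply: le_trans hE _.
  rewrite /expected_cliques ler_wpM2r ?exprn_ge0 ?(ltW p0) // -natrX ler_nat.
  exact: bin_le_expn.
rewrite natr_bin2 in h.
have k1 : 1 <= k%:R :> R by rewrite ler1n.
have kk : 0 < k%:R :> R by lra.
have h2 : 0 <= k%:R * (2 * ln n%:R + ln p * (k%:R - 1)) by lra.
rewrite pmulr_rge0 // in h2.
have h3 : b0 * (k%:R - 1) <= 2 * ln n%:R.
  have : b0 * (k%:R - 1) <= - ln p * (k%:R - 1) by apply: ler_wpM2r => //; lra.
  lra.
have : k%:R - 1 <= 2 * ln n%:R / b0 by rewrite ler_pdivlMr // mulrC.
lra.
Qed.

Lemma le_delta (R : realType) (g g' : R) : g <= g' -> delta g <= delta g'.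
Proof.
move=> h; rewrite /delta ler_wpM2r // le_min !ge_min lexx orbT andbT.
by rewrite lerD2r h.
Qed.

Theorem theorem2p1 (R : realType) (gamma_minus p_plus : R)
    (hgamma : 2 < gamma_minus) (hp : 0 < p_plus < 1)
    (p gamma : nat -> R) (k : nat -> nat)
    (hLambda : in_Lambda gamma_minus p_plus p gamma k)
    (d : nat -> measure_display) (T : forall n : nat, measurableType (d n))
    (P : forall n : nat, probability (T n) R)
    (G : forall n : nat, nat -> T n -> option (graph n))
    (hG : forall n : nat, clique_removal_process (k n) (p n) (P n) (G n)) :
  P n (clique_count_tracked (k n) (p n) (gamma n) (G n)) @[n --> \oo]
    --> (1%:E : \bar R).
Proof.
case: hLambda => Lp Llog Lk Lg Lge; case/andP: hp => pp0 pp1.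
(* The slack does not depend on [n]; since [delta] is monotone, [100 s <= delta (gamma n)] for all
   large [n]. *)
pose s : R := delta gamma_minus / 100.
have dm1 : delta gamma_minus <= 1 / 10.
  by rewrite /delta ler_wpM2r // ge_min lexx orbT.
have dm0 : 0 < delta gamma_minus.
  by rewrite /delta divr_gt0 // lt_min ltr01 andbT subr_gt0.
have s0 : 0 < s by rewrite divr_gt0.
have sE : 100 * s = delta gamma_minus by rewrite /s mulrC divfK.
clearbody s; have s1 : s <= 1 / 4 by lra.
pose b0 : R := - ln p_plus.
have b00 : 0 < b0 by rewrite oppr_gt0 ln_lt0 // pp0.
have s2 : 0 < s ^+ 2 by rewrite exprn_gt0.
have bnd : \forall n \near \oo,
    ((1 - 8 * expR (- s * ln (n%:R : R)))%:E <=
     P n (clique_count_tracked (k n) (p n) (gamma n) (G n)) <= 1%:E)%E.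
  near=> n; apply/andP; split; last first.
    by apply: probability_le1; exact: measurable_tracked (hG n).
  have l1 : 1 <= ln (n%:R : R) by near: n; exact: near_ln_ge.
  have la : 100 / s <= ln (n%:R : R) by near: n; exact: near_ln_ge.
  have lb : 2 / s ^+ 2 <= ln (n%:R : R) by near: n; exact: near_ln_ge.
  have lc : 4 / (s ^+ 2 * b0) <= ln (n%:R : R) by near: n; exact: near_ln_ge.
  have gn : gamma_minus <= gamma n by near: n; exact: Lge.
  have lp : `|ln (p n) / ln n%:R| < s.
    by near: n; move/cvgr0Pnorm_lt : Llog; exact.
  set l : R := ln n%:R in l1 la lb lc lp *.
  have l0 : 0 < l by lra.
  have n0 : (0 < n)%N.
    by rewrite lt0n; apply/eqP => nz; move: l0; rewrite /l nz ln0 // ltxx.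
  have /andP[p0 ppn] := Lp n.
  have p1 : p n < 1 by exact: lt_trans pp1.
  have bn : b0 <= - ln (p n) by rewrite lerN2 ler_ln ?posrE ?ltW.
  have ps : - ln (p n) <= s * l.
    rewrite normrM normfV (gtr0_norm l0) ltr_pdivrMr // in lp.
    by apply: le_trans (ltW lp); rewrite -normrN ler_norm.
  have sl0 : 0 <= s * l by rewrite mulr_ge0 // ltW.
  have X100 : 100 <= expR (s * l).
    rewrite ler_pdivrMr // mulrC in la.
    by apply: le_trans (expR_ge1Dx _); lra.
  have sq := expR_ge_sqr sl0.
  have lX : l <= expR (s * l).
    apply: le_trans sq; rewrite ler_pdivrMr // in lb.
    by have := ler_wpM2r (ltW l0) lb; rewrite exprMn; lra.
  (* [ln] is 0 at nonpositive arguments, so a vanishing expectation, as for [k n > n], also gives a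
     [gamma n] that is not positive. *)
  have E1 : 1 < expected_cliques (p n) n (k n).
    rewrite ltNge; apply/negP => E1; have := ln_le0 E1.
    rewrite leNgt => /negP; apply.
    have : 0 < gamma n by lra.
    by rewrite Lg /gamma_exponent pmulr_lgt0 // invr_gt0.
  have hA : expected_cliques (p n) n (k n) = expR (gamma n * l).
    rewrite Lg /gamma_exponent divfK ?gt_eqF // lnK // posrE; lra.
  (* From [ln (1/p) <= s ln n] and [s <= 1/4], the lower bound [log_(1/p) n] on [k n] is at least
     4. *)
  have k4 : (4 <= k n)%N.
    rewrite -(ler_nat R); apply: le_trans (Lk n).
    rewrite lnV ?posrE // ler_pdivlMr; last by lra.
    have : s * l <= 1 / 4 * l by rewrite ler_wpM2r // ltW.
    by rewrite -/l; lra.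
  have kX : (k n)%:R <= expR (s * l).
    apply: le_trans (clique_size_le n0 _ p0 b00 bn (ltW E1)) _.
      by rewrite (leq_trans _ k4).
    apply: le_trans sq; rewrite lerD2l -/l ler_pdivrMr //.
    rewrite ler_pdivrMr ?mulr_gt0 // in lc.
    by have := ler_wpM2r (ltW l0) lc; rewrite exprMn; lra.
  have k0 : 0 < (k n)%:R :> R by rewrite ltr0n (leq_trans _ k4).
  have ks : ln (k n)%:R <= s * l.
    by rewrite -[leRHS]expRK ler_ln ?posrE ?expR_gt0.
  have kn : (2 * k n <= n)%N.
    rewrite -(ler_nat R) natrM -[leRHS](@lnK _ n%:R) ?posrE ?ltr0n //.
    apply: (@le_trans _ _ (expR (s * l) * expR (s * l))).
      by apply: ler_pM => //; lra.
    rewrite -expRD ler_expR -/l.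
    have : s * l <= 1 / 4 * l by rewrite ler_wpM2r // ltW.
    by lra.
  apply: tracked_prob_ge_fixed => //.
  by rewrite sE; exact: le_delta.
apply: (squeeze_cvge bnd); last exact: cvg_cst.
apply: cvg_EFin; first by near=> n.
apply/cvgrPdist_lt => e e0; near=> n => /=.
rewrite opprB addrC subrK ger0_norm; last by rewrite mulr_ge0 ?expR_ge0.
have h : 8 / e / s <= ln (n%:R : R) by near: n; exact: near_ln_ge.
rewrite ler_pdivrMr // ler_pdivrMr // mulrC [_ * s]mulrC in h.
rewrite mulNr expRN -ltr_pdivlMr ?invr_gt0 ?expR_gt0 // invrK.
rewrite mulrC.
have h2 := expR_ge1Dx (s * ln (n%:R : R)).
have := ler_wpM2l (ltW e0) h2.
by lra.
Unshelve. all: by end_near.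
Qed.
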